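(* Let $\mathbb{F}$ be a field of characteristic $p>0$, let $0\neq h\in\mathbb{F}[x]$, and let $A=A_h$ be the unital $\mathbb{F}$-algebra generated by $x$ and $\hat y$ subject to $\hat y x-x\hat y=h$. Let $\mathsf{Z}(A)$ denote the center of $A$. Then the Hochschild cohomology $\mathrm{HH}^2(A)$ is a free $\mathsf{Z}(A)$-module if and only if $\gcd(h,h')=1$. In this case $\mathrm{HH}^2(A)$ has rank one over $\mathsf{Z}(A)$ and, moreover, $\mathrm{HH}^\bullet(A)=\bigoplus_{n\geq0}\mathrm{HH}^n(A)$ is a free $\mathsf{Z}(A)$-module.
   Context: $h'$ denotes the derivative of $h$ with respect to $x$, and $\gcd$ is taken monic. $\mathrm{HH}^n(A)$ is the Hochschild cohomology of $A$ with coefficients in $A$, which is naturally a module over $\mathsf{Z}(A)=\mathrm{HH}^0(A)$. *)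

(* Defs.v *)
From HB Require Import structures.
From mathcomp Require Import all_boot all_order all_algebra.
Set Implicit Arguments. Unset Strict Implicit. Unset Printing Implicit Defensive.
Import Order.TTheory GRing.Theory Num.Theory.
Local Open Scope ring_scope.

(* Hochschild cohomology HH^n(A, A) of an F-algebra A, built from the
   standard Hochschild cochain complex: an n-cochain is an F-multilinear
   map A^n -> A, represented as a function on sequences (only its values on
   sequences of size n matter). *)

Section Hochschild.
Variables (F : fieldType) (A : algType F).

Definition central (z : A) : Prop := forall a : A, z * a = a * z.

Definition multilinear (n : nat) (f : seq A -> A) : Prop :=
  forall (s : seq A) (i : nat) (k : F) (a b : A),
    size s = n -> (i < n)%N ->
    f (set_nth 0 s i (k *: a + b)) = k *: f (set_nth 0 s i a) + f (set_nth 0 s i b).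

Definition hdiff (n : nat) (f : seq A -> A) (s : seq A) : A :=
  nth 0 s 0 * f (behead s)
  + \sum_(i < n) (-1) ^+ i.+1 *
        f (take i s ++ (nth 0 s i * nth 0 s i.+1) :: drop i.+2 s)
  + (-1) ^+ n.+1 * (f (take n s) * nth 0 s n).

Definition gcochain (D : pred nat) (c : nat -> seq A -> A) : Prop :=
  [/\ forall n, multilinear n (c n),
      forall n s, ~~ D n -> size s = n -> c n s = 0
    & exists N, forall n s, (N <= n)%N -> size s = n -> c n s = 0].

Definition gcocycle (D : pred nat) (c : nat -> seq A -> A) : Prop :=
  gcochain D c /\ forall n s, size s = n.+1 -> hdiff n (c n) s = 0.

Definition gcobound (c : nat -> seq A -> A) : Prop :=
  exists g, gcochain predT g /\
    forall n s, size s = n ->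
      c n s = (if n is m.+1 then hdiff m (g m) s else 0).

Definition lincomb (I : Type) (b : I -> nat -> seq A -> A) (k : nat)
  (idx : 'I_k -> I) (z : 'I_k -> A) : nat -> seq A -> A :=
  fun n s => \sum_(j < k) z j * b (idx j) n s.

(* The Z(A)-module  (cocycles supported in D)/(coboundaries)  is free with a
   basis indexed by I (represented by the cocycles b i). For D = pred1 n this
   is HH^n(A); for D = predT this is HH^*(A) = (+)_n HH^n(A). *)
Definition HH_free_with (D : pred nat) (I : Type) : Prop :=
  exists b : I -> nat -> seq A -> A,
    [/\ forall i, gcocycle D (b i),
        forall c, gcocycle D c ->
          exists k (idx : 'I_k -> I) (z : 'I_k -> A),
            (forall j, central (z j)) /\
            gcobound (fun n s => c n s - lincomb b idx z n s)
      &
        forall k (idx : 'I_k -> I) (z : 'I_k -> A),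
          injective idx -> (forall j, central (z j)) ->
          gcobound (lincomb b idx z) -> forall j, z j = 0].

Definition HH_free (D : pred nat) : Prop := exists I : Type, HH_free_with D I.

End Hochschild.

Definition presented_Ah (F : fieldType) (h : {poly F}) (A : algType F) (x y : A) : Prop :=
  y * x - x * y = horner_alg x h /\
  forall (B : algType F) (b c : B), c * b - b * c = horner_alg b h ->
    exists f : {lrmorphism A -> B},
      [/\ f x = b, f y = c &
          forall g : {lrmorphism A -> B}, g x = b -> g y = c -> forall a, g a = f a].

(* Main.v *)
(* Think of y as h d, where d = d/dx, and let E_j be the element h^j d^j of A,
   so that E_{j+1} = (y - j h') E_j and f xi^j <-> f(x) E_j identifies A with
   F[x][xi] as a left F[x]-module. There [-, x] = h d/dxi, central elements are
   the f with df/dx = df/dxi = 0 and act by the ordinary product, and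
   HH^2(A) is the cokernel of
     d1 (u, v) = h v_xi + h u_x + h' xi u_xi - (xi K u)_xi,
   K u being the sum of h_n x^i u x^j over i + j = n - 1. Modulo xi-derivatives,
   u = c xi^(p-1) contributes (h c' - h' c) xi^(p-1), where c |-> h c' - h' c has
   cokernel free of rank one over F[x^p] when a h + b h' = 1; a generator of it
   is h (b^p h' + a^p h x^(p-1)), by the identity
   h^(p-1) h' = h'^p x^(p-1) + (exact).
   So HH^1 has a basis of two derivations, whose cup product is a basis of HH^2.
   For a cochain f of degree n >= 2, the map a1 |-> f(a1, -) is extended from x, y
   by the relation, and the only obstruction is an element of the cokernel of d1
   (with coefficients in (n-2)-cochains), which vanishes for n >= 3.
   If g = gcd(h, h') is not a unit then im d1 is contained in g A, so 1 is a
   nonzero class, killed by the central element g^p; it is represented by the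
   deformation of A along h + epsilon. *)
Require Import Defs.
From HB Require Import structures.
From mathcomp Require Import all_boot all_order all_algebra.
From mathcomp Require Import boolp zify ring.
Set Implicit Arguments. Unset Strict Implicit. Unset Printing Implicit Defensive.
Import GRing.Theory.
Local Open Scope ring_scope.

(** * Exact polynomials in characteristic p *)

(** Whether a cocycle bounds is decided by lifting A into a square-zero extension of A by cochains.
    Such an extension has only a left unit, because [ract m 1] can differ from [m] in positive
    degree, so the universal property of A does not apply to it. What applies is that A is free as a
    left module over itself: left multiplication in the extension acts on cochains pointwise, so
    each argument list [s] gives two operators on A x A that satisfy the defining relation once the
    obstruction vanishes, and the lift is built one [s] at a time. The field need not be perfect, so
    the scalars in the cokernel computation are the polynomials with zero derivative, which may fail
    to be p-th powers. *)

Section DerivCharp.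
Variables (R : comNzRingType) (p : nat) (hp : p \in [pchar R]).

Lemma pchar_natr_inv n : ~~ (p %| n)%N -> exists m, m%:R * n%:R = 1 :> R.
Proof.
move=> pn; have pp := pcharf_prime hp.
have n0 : (0 < n)%N by case: n pn; rewrite ?dvdn0.
have : coprime n p by rewrite coprime_sym prime_coprime.
case/(coprimeP _ n0) => -[u v] /= uv; exists u.
rewrite -natrM; have -> : (u * n = 1 + v * p)%N by lia.
by rewrite natrD natrM (pcharf0 hp) mulr0 addr0.
Qed.

Lemma pchar_natr_eq0 n (c : R) : ~~ (p %| n)%N -> c *+ n = 0 -> c = 0.
Proof.
move=> /pchar_natr_inv[m mn] cn.
by rewrite -[c]mul1r -mn -mulrA [_%:R * c]mulr_natl cn mulr0.
Qed.

Lemma deriv0_coef (c : {poly R}) i : c^`() = 0 -> ~~ (p %| i)%N -> c`_i = 0.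
Proof.
case: i => [|i] c0 pi; first by rewrite dvdn0 in pi.
by apply: (pchar_natr_eq0 pi); rewrite -coef_deriv c0 coef0.
Qed.

Lemma deriv_exp_pchar (c : {poly R}) : (c ^+ p)^`() = 0.
Proof.
have hP : p \in [pchar {poly R}] by rewrite pchar_poly.
by rewrite deriv_exp -mulr_natr (pcharf0 hP) mulr0.
Qed.

Lemma derivM0 (c q : {poly R}) : c^`() = 0 -> (c * q)^`() = c * q^`().
Proof. by move=> c0; rewrite derivM c0 mul0r add0r. Qed.

(** x^i has the primitive x^(i+1)/(i+1) unless p divides i+1; the exceptional monomials are p-th
    powers times x^(p-1). *)
Lemma exact_decomp (q : {poly R}) :
  exists2 c : {poly R}, c^`() = 0 & exists G : {poly R}, q = c * 'X^(p.-1) + G^`().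
Proof.
have pp := prime_gt0 (pcharf_prime hp).
rewrite -[q]coefK poly_def; elim/big_rec: _ => [|i _ _ [c c0 [G ->]]].
  by exists 0; [rewrite deriv0|exists 0; rewrite deriv0 mul0r addr0].
have [/dvdnP[k ek]|pi] := boolP (p %| i.+1)%N.
  exists (q`_i *: ('X^(k.-1)) ^+ p + c).
    by rewrite derivD derivZ c0 deriv_exp_pchar scaler0 addr0.
  exists G; rewrite mulrDl -!addrA -scalerAl -exprM -exprD; congr (_ *: _ + _).
  congr (_ ^+ _); have : (0 < k)%N by case: k ek.
  by move: ek; case: k => // k; rewrite mulSn /=; lia.
have [m mi] := pchar_natr_inv pi.
exists c => //; exists (m%:R * q`_i *: 'X^(i.+1) + G).
rewrite derivD derivZ derivXn -scaler_nat scalerA [_ + (_ + _)]addrCA /=.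
by rewrite mulrAC mi mul1r.
Qed.

(** A derivative has zero coefficients at the exponents congruent to -1 mod p, and these carry all
    the coefficients of [c * 'X^(p.-1)]. *)
Lemma exact_uniq (c G : {poly R}) : c^`() = 0 -> c * 'X^(p.-1) = G^`() -> c = 0.
Proof.
move=> c0 cG; apply/polyP => i; rewrite coef0.
have pp := prime_gt0 (pcharf_prime hp).
have [pi|] := boolP (p %| i)%N; last exact: deriv0_coef.
have := congr1 (fun q : {poly R} => q`_(i + p.-1)%N) cG.
rewrite coefMXn coef_deriv ltnNge leq_addl /= addnK => ->.
have /dvdnP[k ->] : (p %| (i + p.-1).+1)%N by rewrite -addnS prednK // dvdn_addl.
by rewrite -mulr_natr natrM (pcharf0 hp) !mulr0.
Qed.

End DerivCharp.

(** * Frobenius and the Cartier identity for f^(p-1) f' *)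

Section Frob.
Variables (R : comNzRingType) (p : nat) (hp : p \in [pchar R]).
Lemma exprD_pchar (a b : R) : (a + b) ^+ p = a ^+ p + b ^+ p.
Proof. by rewrite exprDn_pchar // pnatE ?(pcharf_prime hp). Qed.

Lemma exprB_pchar (a b : R) : (a - b) ^+ p = a ^+ p - b ^+ p.
Proof.
by apply/eqP; rewrite eq_sym subr_eq -exprD_pchar subrK.
Qed.

Lemma natr_exp_pchar n : n%:R ^+ p = n%:R :> R.
Proof.
elim: n => [|n IHn]; first by rewrite expr0n eqn0Ngt (prime_gt0 (pcharf_prime hp)).
by rewrite -addn1 natrD exprD_pchar IHn expr1n.
Qed.
End Frob.

Section Cartier.
Variables (R : idomainType) (p : nat) (hp : p \in [pchar R]).

Let cartier (f : {poly R}) :=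
  exists G : {poly R}, f ^+ p.-1 * f^`() = f^`() ^+ p * 'X^(p.-1) + G^`().

(** Subtraction is easier than addition: dividing (f - g)^p = f^p - g^p by f - g shows that (f -
    g)^(p-1) is the sum of the f^(p-1-i) g^i, without binomial coefficients. The cross terms are
    then exact. *)
Let cartierB f g : cartier f -> cartier g -> cartier (f - g).
Proof.
have hP : p \in [pchar {poly R}] by rewrite pchar_poly.
have pp := pcharf_prime hp; have [n pE] : exists n, p = n.+1.
  by exists p.-1; rewrite prednK ?prime_gt0.
move=> [F fF] [G gG]; have [->|fg] := eqVneq f g.
  by exists 0; rewrite subrr deriv0 addr0 mulr0 expr0n pE mul0r.
have expB : (f - g) ^+ n = \sum_(i < n.+1) f ^+ (n - i) * g ^+ i.
  rewrite -subr_eq0 in fg; apply: (mulfI fg).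
  by rewrite -exprS -pE exprB_pchar // pE subrXX.
(* Since p - 1 - i = -(i+1) in characteristic p, each term is the derivative of f^(p-1-i) g^(i+1)
   divided by -(i+1). *)
have [H HE] : exists H : {poly R},
    \sum_(i < n) f ^+ (n.-1 - i) * g ^+ i * (g * f^`() - f * g^`()) = H^`().
  elim/big_rec: _ => [|i q _ [H ->]]; first by exists 0; rewrite deriv0.
  have pi : ~~ (p %| i.+1)%N by rewrite gtnNdvd // pE ltnS ltn_ord.
  have [m mi] := pchar_natr_inv hP pi.
  exists (H - m%:R * (f ^+ (n - i) * g ^+ i.+1)).
  rewrite derivB addrC; congr (_ + _).
  have derm (r : {poly R}) : (m%:R * r)^`() = m%:R * r^`().
    by rewrite !mulr_natl derivMn.
  rewrite derm derivM !deriv_exp /=.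
  have /eqP en : (n - i)%:R == - i.+1%:R :> {poly R}.
    rewrite -addr_eq0 -natrD (_ : (_ + _ = p)%N) ?(pcharf0 hP) //.
    by have := ltn_ord i; lia.
  have en1 : (n - i = (n.-1 - i).+1)%N by have := ltn_ord i; lia.
  rewrite -[_ *+ i.+1]mulr_natr -[_ *+ (n - i)]mulr_natr en en1 /= exprS.
  move: mi => /(congr1 (GRing.mul^~ (f ^+ (n.-1 - i) * g ^+ i * (g * f^`() - f * g^`())))).
  rewrite mul1r => <-; rewrite exprS.
  move: (i.+1%:R : {poly R}) (m%:R : {poly R}) => N M; ring.
exists (H + F - G); rewrite !derivB derivD -HE (exprB_pchar hP) pE /= expB.
rewrite {}pE /= in fF gG *.
transitivity (f ^+ n * f^`() - g ^+ n * g^`()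
  + \sum_(i < n) f ^+ (n.-1 - i) * g ^+ i * (g * f^`() - f * g^`())); last first.
  by rewrite fF gG; ring.
rewrite mulrBr {1}big_ord_recl big_ord_recr /= subn0 subnn expr0 mulr1 mul1r.
rewrite !mulrDl opprD !addrA -[RHS]addrA addrAC -!addrA; congr (_ + _).
rewrite addrCA; congr (_ + _).
rewrite !mulr_suml -sumrB; apply: eq_bigr => i _.
rewrite /bump /= add1n exprS.
have -> : (n - i = (n.-1 - i).+1)%N by have := ltn_ord i; lia.
have -> : (n - i.+1 = (n.-1 - i))%N by have := ltn_ord i; lia.
rewrite exprS; ring.
Qed.

Lemma cartier_exact (f : {poly R}) :
  exists G : {poly R}, f ^+ p.-1 * f^`() = f^`() ^+ p * 'X^(p.-1) + G^`().
Proof.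
have hP : p \in [pchar {poly R}] by rewrite pchar_poly.
have [n pE] : exists n, p = n.+1.
  by exists p.-1; rewrite prednK // prime_gt0 // (pcharf_prime hp).
have cartier0 : cartier 0.
  by exists 0; rewrite !deriv0 addr0 mulr0 expr0n {1}pE mul0r.
rewrite -[f]coefK poly_def; elim/big_rec: _ => [//|i q _ cq].
(* A sum is a difference with 0 - q, so only monomials remain; there the exponent enters once as i
   and once as i^p, which agree by Fermat. *)
rewrite -[q]opprK -[- q]sub0r; apply: cartierB; last exact: cartierB.
exists 0; rewrite deriv0 addr0 derivZ derivXn -!mul_polyC -mulr_natr.
rewrite [_ ^+ p]exprMn [(_ * _%:R) ^+ p]exprMn (natr_exp_pchar hP); case: (i : nat) => [|j].
  by rewrite !mulr0 mul0r.
rewrite pE /= !exprMn !exprS !exprMn.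
move: ('X^j : {poly R}) (_%:P) (j.+1%:R) => Xj c N; ring.
Qed.
End Cartier.

Lemma deriv_expS (R : comNzRingType) (h : {poly R}) k :
  (h ^+ k.+1)^`() = k.+1%:R * (h^`() * h ^+ k).
Proof. by rewrite deriv_exp mulr_natl. Qed.

(** * The cokernel of f |-> h f' when h and h' are coprime *)

Section Coprime.
Variables (F : fieldType) (p : nat) (hp : p \in [pchar F]).
Variables (h a b : {poly F}) (hab : a * h + b * h^`() = 1).

Let hP : p \in [pchar {poly F}]. Proof. by rewrite pchar_poly. Qed.
Let pp : (0 < p)%N. Proof. exact: prime_gt0 (pcharf_prime hp). Qed.
Let cop : coprimep h h^`(). Proof. by apply/Bezout_eq1_coprimepP; exists (a, b). Qed.
Let hn0 : h != 0.
Proof.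
apply/eqP => h0; move: hab; rewrite h0 deriv0 !mulr0 addr0 => /esym/eqP.
by rewrite oner_eq0.
Qed.

(** If c = s h^(k+1) with k + 1 < p, then c' = 0 forces h to divide (k+1) s h', hence s. *)
Lemma dvd_deriv0_exp (c : {poly F}) : c^`() = 0 -> h %| c -> h ^+ p %| c.
Proof.
move=> c0 hc.
suff H k : (k < p)%N -> h ^+ k.+1 %| c by rewrite -[p in _ ^+ p]prednK // H ?prednK.
elim: k => [|k IHk] kp; first by rewrite expr1.
have /IHk : (k < p)%N by apply: ltnW.
case/dvdpP => s cs; rewrite cs [_ ^+ k.+2]exprS dvdp_mul2r ?expf_neq0 //.
have [m mk] : exists m, m%:R * k.+1%:R = 1 :> {poly F}.
  by apply: (pchar_natr_inv hP); rewrite gtnNdvd.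
rewrite -(Gauss_dvdpl _ cop); apply/dvdpP; exists (- m%:R * s^`()).
apply: (mulfI (expf_neq0 k hn0)).
transitivity (m%:R * c^`() - m%:R * s^`() * h ^+ k.+1).
  rewrite cs derivM deriv_expS exprS.
  have -> : s * h^`() = m%:R * k.+1%:R * (s * h^`()) by rewrite mk mul1r.
  by move: (m%:R) (k.+1%:R) => M N; ring.
by rewrite c0 mulr0 exprS; move: (m%:R) => M; ring.
Qed.

(** Substituting x^p and reducing mod h is an F-linear endomorphism of the polynomials of degree
    below deg h. If v is in its kernel, then h^p divides v(x^p), whose degree is less than p deg h,
    so v = 0; by dimension the map is onto. Taking p-th powers instead would not be F-linear. *)
Lemma pth_powers_mod_h (r : {poly F}) :
  exists2 c : {poly F}, c^`() = 0 & exists s, r = c + h * s.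
Proof.
pose n := (size h).-1; pose phi (v : 'rV[F]_n) : 'rV[F]_n :=
  poly_rV ((rVpoly v \Po 'X^p) %% h).
have phi_lin : linear phi.
  by move=> k u v; rewrite /phi linearP /= linearP /= modpD modpZl linearP.
pose phiL : {linear 'rV[F]_n -> 'rV[F]_n} :=
  HB.pack phi (GRing.isLinear.Build _ _ _ _ phi phi_lin).
have modK q : rVpoly (poly_rV (q %% h) : 'rV[F]_n) = q %% h.
  by rewrite poly_rV_K // -ltnS /n prednK ?size_poly_gt0 // ltn_modp.
have der0 q : (q \Po 'X^p)^`() = 0 :> {poly F}.
  by rewrite deriv_comp derivXn -mulr_natr (pcharf0 hP) !mulr0.
have sXp : (1 < size ('X^p : {poly F}))%N by rewrite size_polyXn.
have : lin1_mx phiL \in unitmx.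
  rewrite -row_free_unit; apply: inj_row_free => v; rewrite mul_rV_lin1 /= => v0.
  have hc : h %| rVpoly v \Po 'X^p by rewrite /dvdp -modK -/(phi v) v0 linear0.
  apply: (can_inj rVpolyK); rewrite linear0; apply/eqP.
  rewrite -(comp_poly_eq0 _ sXp); apply: contraT => cn0.
  have := dvdp_leq cn0 (dvd_deriv0_exp (der0 _) hc).
  have vn0 : rVpoly v != 0 by apply: contra cn0 => /eqP->; rewrite comp_poly0.
  have sv : (0 < size (rVpoly v) <= n)%N by rewrite size_poly_gt0 vn0 size_poly.
  have := size_comp_poly (rVpoly v) 'X^p; have := size_exp h p; rewrite size_polyXn /= -/n.
  have : (0 < size (h ^+ p))%N by rewrite size_poly_gt0 expf_neq0.
  move: (size (h ^+ p)) (size (_ \Po _)) (size (rVpoly v)) sv => s1 s2 s3; nia.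
move=> U; pose w := poly_rV (r %% h) *m invmx (lin1_mx phiL).
exists (rVpoly w \Po 'X^p) => //.
have : phiL w = poly_rV (r %% h) by rewrite -mul_rV_lin1 mulmxKV.
move=> /(congr1 rVpoly); rewrite /= /phi !modK => E.
exists (r %/ h - (rVpoly w \Po 'X^p) %/ h).
by rewrite {1}(divp_eq r h) {1}(divp_eq (rVpoly w \Po 'X^p) h) E; ring.
Qed.

(** Each integration by parts raises the exponent of the remainder by one: Bezout puts h' in front
    of r, and h^k h' is the derivative of h^(k+1)/(k+1). The process stops at h^p, where p would
    have to be inverted. *)
Lemma exact_mod_h_power q k : (0 < k <= p)%N ->
  exists f r : {poly F}, h * q = h * f^`() + h ^+ k * r.
Proof.
elim: k => // -[|k] IHk kp; first by exists 0, q; rewrite deriv0 mulr0 add0r expr1.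
have [f [r E]] := IHk (ltnW kp).
have [m mk] : exists m, m%:R * k.+1%:R = 1 :> {poly F}.
  by apply: (pchar_natr_inv hP); rewrite gtnNdvd.
pose g := m%:R * b * r.
exists (f + h ^+ k.+1 * g), (a * r - g^`()).
rewrite E derivD derivM deriv_expS.
have -> : h ^+ k.+1 * r = h ^+ k.+1 * ((a * h + (m%:R * k.+1%:R) * b * h^`()) * r).
  by rewrite mk mul1r hab mul1r.
move: (g^`()) => g'; rewrite /g; move: (k.+1%:R) (m%:R) => N M; rewrite !exprS; ring.
Qed.

(** Modulo h times derivatives, h' and h x^(p-1) generate, and the Cartier identity times h gives
    h^p h' = h'^p (h x^(p-1)). Since a^p h^p + b^p h'^p = 1, the two are h'^p and h^p times this
    combination of them. *)
Definition coker_gen : {poly F} := b ^+ p * h^`() + a ^+ p * h * 'X^(p.-1).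

Let habp : a ^+ p * h ^+ p + b ^+ p * h^`() ^+ p = 1.
Proof. by rewrite -!exprMn -(exprD_pchar hP) hab expr1n. Qed.

Let derM0 (c q : {poly F}) : (c ^+ p * q)^`() = c ^+ p * q^`().
Proof. by rewrite derivM0 // (deriv_exp_pchar hp). Qed.

Lemma coker_genP (q : {poly F}) :
  exists2 c : {poly F}, c^`() = 0 & exists f, q = c * coker_gen + h * f^`().
Proof.
(* Bezout writes q = (q b) h' + h (q a). The coefficient of h' is made constant modulo h, and the
   rest is pushed up to h h^(p-1) r, where only a term in x^(p-1) survives integration. *)
have [c c0 [s E1]] := pth_powers_mod_h (q * b).
have [f [r E2]] := @exact_mod_h_power (s * h^`() + q * a) p (introT andP (conj pp (leqnn p))).
have [d d0 [G E3]] := exact_decomp hp (h ^+ p.-1 * r).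
have [G' E4] := cartier_exact hp h.
have hpE : h ^+ p = h * h ^+ p.-1 by rewrite -exprS prednK.
exists (c * h^`() ^+ p + d * h ^+ p).
  by rewrite derivD !derivM c0 d0 !(deriv_exp_pchar hp) !mulr0 !mul0r !addr0.
exists (a ^+ p * c * G' + f + G - b ^+ p * d * G').
rewrite derivB !derivD -!mulrA !derM0 !(derivM0 _ c0) !(derivM0 _ d0).
have G'E : G'^`() = h ^+ p.-1 * h^`() - h^`() ^+ p * 'X^(p.-1) by rewrite E4; ring.
have K1 : h^`() = h^`() ^+ p * coker_gen + a ^+ p * h * G'^`().
  by rewrite -{1}[h^`()]mul1r -habp G'E /coker_gen hpE; ring.
have K2 : h * 'X^(p.-1) = h ^+ p * coker_gen - h * b ^+ p * G'^`().
  by rewrite -{1}[h * 'X^(_)]mul1r -habp G'E /coker_gen hpE; ring.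
transitivity (c * h^`() + h * f^`() + d * (h * 'X^(p.-1)) + h * G^`()); last first.
  by rewrite K2 {1}K1; ring.
transitivity (q * b * h^`() + h * (q * a)).
  by rewrite -[LHS]mulr1 -hab; ring.
transitivity (c * h^`() + h * (s * h^`() + q * a)); first by rewrite E1; ring.
by rewrite E2 hpE -mulrA E3; ring.
Qed.

(** It suffices that c x^(p-1) is exact. Split it by a^p h^p + b^p h'^p = 1 and replace h'^p x^(p-1)
    by the Cartier identity; up to exact terms, h^(p-1) c [coker_gen] = h^p f' is left. *)
Lemma coker_gen_free (c f : {poly F}) :
  c^`() = 0 -> c * coker_gen = h * f^`() -> c = 0.
Proof.
move=> c0 E; have [G EG] := cartier_exact hp h.
have hpE : h ^+ p = h * h ^+ p.-1 by rewrite -exprS prednK.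
apply: (exact_uniq hp (G := h ^+ p * f - b ^+ p * (c * G))) => //.
rewrite derivB !derM0 (derivM0 _ c0) hpE mulrAC -E /coker_gen.
have -> : c * 'X^(p.-1) = c * 'X^(p.-1) * (a ^+ p * h ^+ p + b ^+ p * h^`() ^+ p).
  by rewrite habp mulr1.
rewrite hpE.
move/eqP: EG; rewrite addrC -subr_eq => /eqP <-; ring.
Qed.
End Coprime.

(** * The differential operator model *)

Lemma deriv_mulC (R : nzRingType) (c : R) (v : {poly R}) :
  (c%:P * v)^`() = c%:P * v^`().
Proof. by rewrite derivM derivC mul0r add0r. Qed.

Section Dx.
Variable F : fieldType.
Implicit Types (u v : {poly {poly F}}) (c : {poly F}).

Definition dx v : {poly {poly F}} := map_poly deriv v.

Lemma coef_dx v i : (dx v)`_i = (v`_i)^`().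
Proof. by rewrite coef_map_id0 ?linear0. Qed.

Fact dx_is_zmod_morphism : zmod_morphism dx.
Proof. by move=> u v; apply/polyP => i; rewrite coefB !coef_dx coefB linearB. Qed.
HB.instance Definition _ := GRing.isZmodMorphism.Build _ _ dx dx_is_zmod_morphism.

Definition const v := v^`() = 0 /\ dx v = 0.

Lemma dx0 : dx 0 = 0. Proof. exact: raddf0. Qed.
Lemma dxN v : dx (- v) = - dx v. Proof. exact: raddfN. Qed.
Lemma dxD u v : dx (u + v) = dx u + dx v. Proof. exact: raddfD. Qed.
Lemma dxB u v : dx (u - v) = dx u - dx v. Proof. exact: raddfB. Qed.

Lemma dxM u v : dx (u * v) = dx u * v + u * dx v.
Proof.
apply/polyP => i; rewrite coefD !coefM coef_dx coefM linear_sum -big_split /=.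
by apply: eq_bigr => j _; rewrite derivM !coef_dx.
Qed.

Lemma dxC c : dx c%:P = c^`()%:P.
Proof. by rewrite /dx map_polyC. Qed.

Lemma dx1 : dx 1 = 0.
Proof. by rewrite -polyC1 dxC derivC. Qed.

Lemma dxX : dx 'X = 0.
Proof.
by apply/polyP => i; rewrite coef_dx coefX coef0; case: (i == 1%N); rewrite ?derivC.
Qed.

Lemma dxXn n : dx 'X^n = 0.
Proof. by elim: n => [|n IHn]; rewrite ?dx1 // exprS dxM IHn dxX mul0r mulr0 addr0. Qed.

Lemma deriv_dx v : (dx v)^`() = dx v^`().
Proof. by apply/polyP => i; rewrite coef_deriv !coef_dx coef_deriv derivMn. Qed.
End Dx.

Section Ops.
Variables (F : fieldType) (h : {poly F}).
Local Notation V := {poly {poly F}}.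
Local Notation x := ('X%:P : V).
Implicit Types (u v w : V).

(* [ly] is left multiplication by y, [rx] and [ry] are right multiplication by x
   and y; [ry] is determined by h (ry v) = xi (h(rx) v), see [h_ry]. *)
Definition ly v : V := h%:P * dx v + h^`()%:P * ('X * v^`()) + 'X * v.
Definition rx v : V := x * v + h%:P * v^`().
Fixpoint Kn n v : V := if n is n'.+1 then x * Kn n' v + iter n' rx v else 0.
Definition Ksum v : V := \sum_(i < size h) (h`_i)%:P%:P * Kn i v.
Definition ry v : V := 'X * (v + (Ksum v)^`()).
Definition rh v : V := \sum_(i < size h) (h`_i)%:P%:P * iter i rx v.

(** Right multiplication by x and the operators derived from it are of this kind; the last clause
    lets xi-derivatives pass through [Ksum], so that exact arguments give exact values. *)
Record dlin (T : V -> V) : Prop := DLin {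
  dlinD : forall u v, T (u + v) = T u + T v;
  dlinC : forall c v, T (c%:P * v) = c%:P * T v;
  dlinX : forall v, (T v)^`() = T v^`() }.

Lemma dlin0 T : dlin T -> T 0 = 0.
Proof. by move=> nT; rewrite -[X in T X](mul0r 0) -polyC0 dlinC // polyC0 mul0r. Qed.

Lemma dlin_id : dlin id. Proof. by []. Qed.

Lemma dlin_cst0 : dlin (fun=> 0).
Proof. by split=> *; rewrite ?addr0 ?mulr0 ?deriv0. Qed.

Lemma dlin_scale c T : dlin T -> dlin (fun v => c%:P * T v).
Proof.
move=> nT; split=> [u v|d v|v]; rewrite ?(dlinD nT) ?(dlinC nT) ?mulrDr //.
  by rewrite mulrCA.
by rewrite deriv_mulC dlinX.
Qed.

Lemma dlin_add T1 T2 : dlin T1 -> dlin T2 -> dlin (fun v => T1 v + T2 v).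
Proof.
move=> n1 n2; split=> [u v|d v|v].
- by rewrite (dlinD n1) (dlinD n2) addrACA.
- by rewrite (dlinC n1) (dlinC n2) mulrDr.
- by rewrite derivD (dlinX n1) (dlinX n2).
Qed.

Lemma dlin_comp T1 T2 : dlin T1 -> dlin T2 -> dlin (fun v => T1 (T2 v)).
Proof.
by move=> n1 n2; split=> *; rewrite ?(dlinD n2) ?(dlinC n2) ?(dlinD n1) ?(dlinC n1)
  ?(dlinX n1) ?(dlinX n2).
Qed.

Lemma dlin_sum n (c : nat -> {poly F}) (T : nat -> V -> V) :
  (forall i, dlin (T i)) -> dlin (fun v => \sum_(i < n) (c i)%:P * T i v).
Proof.
move=> nT; split=> [u v|d v|v].
- by rewrite -big_split; apply: eq_bigr => i _; rewrite (dlinD (nT i)) mulrDr.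
- by rewrite mulr_sumr; apply: eq_bigr => i _; rewrite (dlinC (nT i)) mulrCA.
- by rewrite raddf_sum /=; apply: eq_bigr => i _; rewrite deriv_mulC (dlinX (nT i)).
Qed.

Lemma dlin_deriv : dlin (fun v => v^`()).
Proof. by split=> *; rewrite ?derivD ?deriv_mulC. Qed.

Lemma dlin_rx : dlin rx.
Proof. exact: dlin_add (dlin_scale _ dlin_id) (dlin_scale _ dlin_deriv). Qed.

Lemma dlin_iter n : dlin (iter n rx).
Proof. by elim: n => [|n IHn] //; apply: dlin_comp dlin_rx IHn. Qed.

Lemma dlin_Kn n : dlin (Kn n).
Proof.
elim: n => [|n IHn] /=; first exact: dlin_cst0.
exact: dlin_add (dlin_scale _ IHn) (dlin_iter n).
Qed.

Lemma dlin_Ksum : dlin Ksum.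
Proof. exact: (dlin_sum (size h) (fun i => (h`_i)%:P) dlin_Kn). Qed.

(** h d/dxi is the commutator with x, under which the sum of the x^i v x^j telescopes. *)
Lemma deriv_Kn n v : h%:P * (Kn n v)^`() = iter n rx v - x ^+ n * v.
Proof.
elim: n => [|n IHn] /=; first by rewrite deriv0 mulr0 mul1r subrr.
rewrite derivD deriv_mulC mulrDr mulrCA IHn {3}/rx exprS; ring.
Qed.

Lemma polyCC_coef (q : {poly F}) : q%:P = \sum_(i < size q) (q`_i)%:P%:P * x ^+ i :> V.
Proof.
rewrite -{1}[q]coefK poly_def rmorph_sum; apply: eq_bigr => i _.
by rewrite -mul_polyC rmorphM rmorphXn.
Qed.

Lemma deriv_Ksum v : h%:P * (Ksum v)^`() = rh v - h%:P * v.
Proof.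
rewrite raddf_sum /= mulr_sumr [X in _ - X * v]polyCC_coef mulr_suml -sumrB.
apply: eq_bigr => i _; rewrite deriv_mulC mulrCA deriv_Kn; ring.
Qed.

Lemma Kn_mod n : exists2 W, dlin W &
  forall v, Kn n v = ('X^n)^`()%:P * v + h%:P * W v^`().
Proof.
elim: n => [|n [W nW IHn]].
  exists (fun=> 0) => [|v] /=; first exact: dlin_cst0.
  by rewrite expr0 derivC mulr0 mul0r addr0.
exists (fun v => x * W v + Kn n v) => [|v] /=.
  exact: dlin_add (dlin_scale _ nW) (dlin_Kn n).
have -> : iter n rx v = x ^+ n * v + h%:P * Kn n v^`().
  by rewrite -(dlinX (dlin_Kn n)) deriv_Kn; ring.
rewrite IHn exprS derivM derivX mul1r !rmorphD rmorphM rmorphXn /=.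
by move: (W _) (Kn _ _) (_^`()%:P) => w k c; ring.
Qed.

(** Moving each right factor x to the left costs a multiple of h applied to v_xi; the terms without
    commutators add up to h' v. This is what puts the image of [d1] into the ideal of h and h'. *)
Lemma Ksum_mod : exists2 W, dlin W &
  forall v, Ksum v = h^`()%:P * v + h%:P * W v^`().
Proof.
suff [W nW WE] : exists2 W, dlin W & forall v, Ksum v =
    (\sum_(i < size h) (h`_i)%:P%:P * ('X^i)^`()%:P) * v + h%:P * W v^`().
  exists W => // v; rewrite WE; congr (_ * v + _).
  rewrite -[in RHS](coefK h) poly_def raddf_sum rmorph_sum; apply: eq_bigr => i _.
  by rewrite /= derivZ -mul_polyC rmorphM.
rewrite /Ksum; elim: (size h) => [|n [W nW IHn]].
  by exists (fun=> 0) => [|v]; [exact: dlin_cst0|rewrite !big_ord0 mul0r mulr0 addr0].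
have [W' nW' KE] := Kn_mod n.
exists (fun v => W v + (h`_n)%:P%:P * W' v) => [|v].
  exact: dlin_add nW (dlin_scale _ nW').
by rewrite !big_ord_recr /= IHn KE; ring.
Qed.

Lemma lyD u v : ly (u + v) = ly u + ly v.
Proof. by rewrite /ly dxD derivD; ring. Qed.

Lemma lyC (k : F) v : ly (k%:P%:P * v) = k%:P%:P * ly v.
Proof. by rewrite /ly dxM dxC derivC mul0r add0r deriv_mulC; ring. Qed.

Lemma ly_sum n (c : nat -> F) (T : nat -> V) :
  ly (\sum_(i < n) (c i)%:P%:P * T i) = \sum_(i < n) (c i)%:P%:P * ly (T i).
Proof.
elim: n => [|n IHn]; last by rewrite !big_ord_recr lyD IHn lyC.
by rewrite !big_ord0 /ly dx0 deriv0; ring.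
Qed.

Lemma ly_polyC c v : ly (c%:P * v) = c%:P * ly v + h%:P * c^`()%:P * v.
Proof. by rewrite /ly dxM dxC deriv_mulC; ring. Qed.

Lemma ly_rx v : ly (rx v) = rx (ly v).
Proof.
rewrite {1}/rx lyD !ly_polyC derivX /rx /ly !derivD !deriv_mulC deriv_dx derivM derivX.
rewrite derivM derivX; ring.
Qed.

Lemma ly_rh v : ly (rh v) = rh (ly v).
Proof.
rewrite (ly_sum _ (fun i => h`_i) (fun i => iter i rx v)); apply: eq_bigr => i _.
by congr (_ * _); elim: (i : nat) => //= n <-; rewrite ly_rx.
Qed.

Lemma h_ry v : h%:P * ry v = 'X * rh v.
Proof. by rewrite /ry mulrCA mulrDr deriv_Ksum; congr (_ * _); ring. Qed.

(** Times h, right multiplication by y is xi times right multiplication by h(x), and the latter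
    commutes with [ly]. The commutators of [ly] with h and with xi produce the same term, which
    cancels. *)
Lemma ly_ry v : h != 0 -> ly (ry v) = ry (ly v).
Proof.
move=> h0; have hP0 : h%:P != 0 :> V by rewrite polyC_eq0.
apply: (mulfI hP0); rewrite h_ry -ly_rh.
have -> : h%:P * ly (ry v) = ly ('X * rh v) - h^`()%:P * ('X * rh v).
  by rewrite -h_ry ly_polyC; ring.
by rewrite {1}/ly dxM dxX derivM derivX /ly; ring.
Qed.

Definition Sop u : V := h%:P * dx u + h^`()%:P * ('X * u^`()) - ('X * Ksum u)^`().
Definition d1 u v : V := h%:P * v^`() + Sop u.

Lemma Sop_mod u : exists w, Sop u = - h^`()%:P * u + h%:P * w.
Proof.
have [W nW KE] := Ksum_mod.
exists (dx u - ('X * W u^`())^`()).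
by rewrite /Sop KE !derivM derivD derivX !deriv_mulC; ring.
Qed.

(** The shape of the primitive matters: in [d1_exact] its term -h' b is completed by a multiple of h
    to an arbitrary primitive, through Bezout. *)
Lemma Sop_deriv b : exists w, Sop b^`() = (- h^`()%:P * b + h%:P * w)^`().
Proof.
have [W nW KE] := Ksum_mod.
exists (dx b - 'X * (W b^`())^`()).
rewrite /Sop -(dlinX dlin_Ksum) KE.
rewrite !(derivD, derivM, derivN, derivB, deriv_mulC, derivX, derivC, deriv_dx).
by rewrite -deriv_dx; ring.
Qed.

Lemma d1_polyC (r s : {poly F}) : d1 r%:P (s%:P * 'X) = (h * s + h * r^`() - h^`() * r)%:P.
Proof.
have [W nW KE] := Ksum_mod.
rewrite /d1 /Sop KE derivC (dlin0 nW) !(derivM, derivC, derivD, derivX) dxC.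
by rewrite !(rmorphD, rmorphB, rmorphM) /=; ring.
Qed.

End Ops.

(** * The two-term Koszul complex of the model *)

Section D1.
Variables (F : fieldType) (h : {poly F}).
Local Notation V := {poly {poly F}}.
Implicit Types u v : V.

Lemma SopD u v : Sop h (u + v) = Sop h u + Sop h v.
Proof.
by rewrite /Sop (dlinD (dlin_Ksum h)) dxD !(mulrDr, derivD); ring.
Qed.

Lemma d1D u u' v v' : d1 h (u + u') (v + v') = d1 h u v + d1 h u' v'.
Proof. by rewrite /d1 SopD derivD; ring. Qed.

Lemma d1_dvd (g r s : {poly F}) u v : h = g * r -> h^`() = g * s ->
  exists w, d1 h u v = g%:P * w.
Proof.
move=> hg h'g; have [w Sw] := Sop_mod h u.
exists (r%:P * v^`() - s%:P * u + r%:P * w).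
by rewrite /d1 Sw h'g {1 2}hg !rmorphM /=; ring.
Qed.
End D1.

(** * Kernel and cokernel of [d1] when h and h' are coprime *)

Section Coprime.
Variables (F : fieldType) (p : nat) (hp : p \in [pchar F]).
Variables (h a b : {poly F}) (hab : a * h + b * h^`() = 1).
Local Notation V := {poly {poly F}}.
Local Notation e1 := (coker_gen p h a b).
Local Notation Xp := ('X^(p.-1) : V).
Implicit Types (u v w z c : V).

Let hP : p \in [pchar {poly F}]. Proof. by rewrite pchar_poly. Qed.
Let habP c : c = a%:P * h%:P * c + b%:P * h^`()%:P * c.
Proof. by rewrite -mulrDl -!rmorphM -rmorphD hab mul1r. Qed.
Let hn0 : h != 0.
Proof.
apply/eqP => h0; move: hab; rewrite h0 deriv0 !mulr0 addr0 => /esym/eqP.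
by rewrite oner_eq0.
Qed.
Let hPn0 : h%:P != 0 :> V. Proof. by rewrite polyC_eq0. Qed.

(** A vanishing xi-derivative leaves only powers of xi^p, which are constants, so [coker_genP]
    applies to each coefficient. *)
Lemma coker_genP2 c : c^`() = 0 -> exists2 z, const z &
  exists2 f, f^`() = 0 & c = z * e1%:P + h%:P * dx f.
Proof.
move=> c0; rewrite -[c]coefK poly_def.
elim/big_rec: _ => [|i q _ [z [z0 z1] [f f0 ->]]].
  by exists 0; [split; rewrite ?deriv0 ?dx0|exists 0; rewrite ?deriv0 ?dx0 ?mulr0 ?mul0r ?addr0].
have [pi|pi] := boolP (p %| i)%N; last first.
  by exists z => //; exists f => //; rewrite (deriv0_coef hP c0) // scale0r add0r.
have [d d0 [g E]] := coker_genP hp hab c`_i.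
have X0 (q' : {poly F}) : (q'%:P * 'X^i)^`() = 0 :> V.
  case/dvdnP: pi => k ->; rewrite deriv_mulC exprM.
  by rewrite (deriv_exp_pchar hP) mulr0.
exists (d%:P * 'X^i + z).
  by split; rewrite ?derivD ?dxD /= ?dxM ?dxXn ?dxC ?X0 ?d0 ?z0 ?z1 ?mul0r ?mulr0 ?addr0.
exists (g%:P * 'X^i + f); first by rewrite derivD X0 f0 addr0.
rewrite dxD /= dxM dxC dxXn mulr0 addr0 E -mul_polyC rmorphD !rmorphM /=; ring.
Qed.

Lemma coker_gen_free2 z f : dx z = 0 -> z * e1%:P = h%:P * dx f -> z = 0.
Proof.
move=> z0 E; apply/polyP => i; rewrite coef0.
apply: (coker_gen_free hp hab (f := f`_i)).
  by rewrite -coef_dx z0 coef0.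
by have := congr1 (fun q : V => q`_i) E; rewrite coefMC coefCM coef_dx.
Qed.

Let XX : 'X * Xp^`() = - Xp.
Proof.
have [n pE] : exists n, p = n.+2.
  by exists p.-2; case: p (prime_gt1 (pcharf_prime hp)) => [|[]].
have hV : p \in [pchar V] by rewrite pchar_poly.
apply/eqP; rewrite -subr_eq0 opprK derivXn pE /= mulrnAr -exprS -mulrSr.
by rewrite -mulr_natr -pE (pcharf0 hV) mulr0.
Qed.

Lemma Sop_Xp c : c^`() = 0 -> exists E,
  Sop h (c * Xp) = (h%:P * dx c - h^`()%:P * c) * Xp + E^`().
Proof.
move=> c0; exists (- ('X * Ksum h (c * Xp))).
rewrite /Sop dxM dxXn (derivM0 _ c0) derivN mulr0 addr0 [X in _%:P * X + _]mulrC.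
rewrite [X in h^`()%:P * X]mulrCA XX; ring.
Qed.

Lemma d1_exact w : exists u v, w^`() = d1 h u v.
Proof.
have [m E] := Sop_deriv h (- b%:P * w).
exists (- b%:P * w)^`(), (a%:P * w - m).
by rewrite /d1 E -deriv_mulC -derivD {1}[w]habP; congr deriv; ring.
Qed.

Lemma d1_decomp w : exists2 z, const z &
  exists u v, w = z * ((h * e1)%:P * Xp) + d1 h u v.
Proof.
have [c c0 [G ->]] := exact_decomp hP w.
(* Modulo the image of g |-> h g_x - h' g, Bezout turns c into h q: subtract the image of -b c. In
   the decomposition of q the part h f_x is absorbed as well, since h (h f_x) is the image of h
   f. *)
pose q := a%:P * c + dx (b%:P * c).
have q0 : q^`() = 0 by rewrite derivD deriv_dx !deriv_mulC c0 !mulr0 dx0 addr0.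
have [z zc [f f0 qE]] := coker_genP2 q0.
pose g := h%:P * f - b%:P * c.
have g0 : g^`() = 0 by rewrite derivB !deriv_mulC c0 f0 !mulr0 subr0.
have [E SE] := Sop_Xp g0; have [u [v uvE]] := d1_exact (G - E).
exists z => //; exists (g * Xp + u), (0 + v).
rewrite d1D -uvE {1}/d1 SE deriv0 derivB.
have -> : c = h%:P * q + (h%:P * dx (- (b%:P * c)) - h^`()%:P * - (b%:P * c)).
  by rewrite dxN {1}[c]habP /q; ring.
rewrite qE /g dxB dxM dxC dxN rmorphM /=; ring.
Qed.

(** Comparing the coefficients of xi^(p-1) modulo exact terms gives z h [e1] = h c_x - h' c. Hence h
    divides c, and c = h f leaves z [e1] = h f_x. *)
Lemma d1_free z G u v : const z ->
  z * ((h * e1)%:P * Xp) + G^`() = d1 h u v -> z = 0.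
Proof.
move=> [z0 z1] E; have [c c0 [B uE]] := exact_decomp hP u.
have [w wE] := Sop_deriv h B; have [E' SE] := Sop_Xp c0.
have zE : z * (h * e1)%:P - (h%:P * dx c - h^`()%:P * c) = 0.
  apply: (exact_uniq hP
     (G := h%:P * v + E' + (- h^`()%:P * B + h%:P * w) - G)).
    rewrite !(derivB, derivD, deriv_mulC) derivM derivC mulr0 deriv_dx c0 z0.
    by rewrite dx0; ring.
  rewrite derivB derivD -wE derivD deriv_mulC; apply/eqP.
  move/eqP: E; rewrite /d1 uE SopD SE -subr_eq0 => /eqP E.
  by rewrite -subr_eq0 -[X in _ == X]E; apply/eqP; ring.
have cE : c = h%:P * (a%:P * c + b%:P * (dx c - z * e1%:P)).
  rewrite {1}[c]habP mulrDr; congr (_ + _); first ring.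
  move/eqP: zE; rewrite subr_eq0 rmorphM /= => /eqP zE.
  apply/eqP; rewrite -subr_eq0; apply/eqP.
  transitivity (b%:P * (z * (h%:P * e1%:P) - (h%:P * dx c - h^`()%:P * c))); first ring.
  by rewrite zE; ring.
move: (_ + _) cE zE => f ->; rewrite dxM dxC rmorphM /= => zE.
apply: (@coker_gen_free2 _ f) => //; apply: (mulfI hPn0).
by apply/eqP; rewrite -subr_eq0 -[X in _ == X]zE; apply/eqP; ring.
Qed.

(** Modulo h, [d1 h u v] is -h' u, so h divides u. For u = h (c xi^(p-1) + B_xi) the xi^(p-1) part
    of the equation is h^2 c_x = 0; the term h B_xi is the value at x of an inner derivation. *)
Lemma ker_d1_left u v : d1 h u v = 0 -> exists2 z, const z &
  exists B, u = z * (h%:P * Xp) + h%:P * B^`().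
Proof.
move=> E; have [w Sw] := Sop_mod h u.
have uE : u = h%:P * (a%:P * u + b%:P * (v^`() + w)).
  rewrite {1}[u]habP mulrDr; congr (_ + _); first ring.
  apply/eqP; rewrite -subr_eq0; apply/eqP.
  transitivity (- b%:P * d1 h u v); last by rewrite E mulr0.
  by rewrite /d1 Sw; ring.
have [c c0 [B mE]] := exact_decomp hP (a%:P * u + b%:P * (v^`() + w)).
have uE' : u = h%:P * c * Xp + (h%:P * B)^`() by rewrite uE mE deriv_mulC; ring.
have hc0 : (h%:P * c)^`() = 0 by rewrite deriv_mulC c0 mulr0.
have [w' wE] := Sop_deriv h (h%:P * B); have [E' SE] := Sop_Xp hc0.
exists c; last by exists B; rewrite uE' deriv_mulC; ring.
split=> //; have : h%:P * dx (h%:P * c) - h^`()%:P * (h%:P * c) = 0.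
  apply: (exact_uniq hP
     (G := - (h%:P * v + E' + (- h^`()%:P * (h%:P * B) + h%:P * w')))).
    by rewrite !(derivB, derivD, deriv_mulC) deriv_dx deriv_mulC c0 !mulr0 dx0; ring.
  rewrite derivN derivD -wE derivD deriv_mulC; apply/eqP.
  move: E; rewrite /d1 uE' SopD SE => E.
  by rewrite -subr_eq0 -[X in _ == X]E; apply/eqP; ring.
rewrite dxM dxC => hh; apply: (mulfI hPn0); apply: (mulfI hPn0).
by rewrite !mulr0 -[RHS]hh; ring.
Qed.

Lemma ker_d1_right v : d1 h 0 v = 0 -> exists2 z, const z &
  exists2 f, f^`() = 0 & v = z * e1%:P + h%:P * dx f.
Proof.
rewrite /d1 /Sop (dlin0 (dlin_Ksum h)) dx0 !(mulr0, deriv0, addr0, subr0).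
by move=> /eqP; rewrite mulf_eq0 (negPf hPn0) => /eqP; apply: coker_genP2.
Qed.

(** For u = h xi^(p-1) the term h' xi u_xi is -h' u and cancels h u_x; the second component is
    chosen so that h v_xi cancels the term with [Ksum]. *)
Lemma d1_gen1 : d1 h (h%:P * Xp) ('X * Ksum h Xp) = 0.
Proof.
rewrite /d1 /Sop dxM dxXn dxC (dlinC (dlin_Ksum h)) deriv_mulC.
rewrite [X in h^`()%:P * X]mulrCA XX [X in _ - X^`()]mulrCA deriv_mulC; ring.
Qed.
End Coprime.

(** * Modules over the presented algebra *)

Section PolySum.
Variables (R : nzRingType) (W : zmodType) (T : nat -> R -> W).
Hypothesis T0 : forall i, T i 0 = 0.

Definition polysum (v : {poly R}) : W := \sum_(i < size v) T i v`_i.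

Lemma polysum_widen n (v : {poly R}) : (size v <= n)%N -> polysum v = \sum_(i < n) T i v`_i.
Proof.
move=> vn; rewrite /polysum (big_ord_widen n (fun i => T i v`_i) vn) big_mkcond.
by apply: eq_bigr => i _; case: ltnP => // /(nth_default 0)->; rewrite T0.
Qed.

Lemma polysumD u v : (forall i a b, T i (a + b) = T i a + T i b) ->
  polysum (u + v) = polysum u + polysum v.
Proof.
move=> TD; pose n := maxn (size u) (size v).
rewrite (polysum_widen (size_polyD _ _)) -/n.
rewrite (@polysum_widen n u) ?leq_maxl // (@polysum_widen n v) ?leq_maxr //.
by rewrite -big_split; apply: eq_bigr => i _; rewrite coefD TD.
Qed.

Lemma polysumXn n : polysum 'X^n = T n 1.
Proof.
rewrite (@polysum_widen n.+1) ?size_polyXn // big_ord_recr /= coefXn eqxx.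
rewrite big1 ?add0r // => i _; rewrite coefXn.
by rewrite ltn_eqF ?T0.
Qed.
End PolySum.

Section Ext.
Variables (F : fieldType) (h : {poly F}).
Local Notation V := {poly {poly F}}.
Local Notation x := ('X%:P : V).

Lemma Vind (P : V -> Prop) :
  (forall k u v, P u -> P v -> P (k%:P%:P * u + v)) -> P 0 ->
  (forall v, P v -> P (x * v)) -> (forall j, P 'X^j) -> forall v, P v.
Proof.
move=> Plin P0 Px PX v; rewrite -[v]coefK poly_def.
elim/big_rec: _ => // i u _ Pu; rewrite -mul_polyC polyCC_coef mulr_suml.
elim: (size _) => [|n IHn]; first by rewrite big_ord0 add0r.
rewrite big_ord_recr /= -addrA addrCA -mulrA; apply: Plin => //.
by elim: n {IHn} => [|n IHn]; rewrite ?mul1r // exprS -mulrA; apply: Px.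
Qed.

Lemma ly_Xn j : ly h 'X^j = (h^`() *+ j)%:P * 'X^j + 'X^(j.+1).
Proof.
rewrite /ly dxXn mulr0 add0r derivXn exprS; congr (_ + _); case: j => [|j].
  by rewrite !mulr0n !mulr0 mul0r.
by rewrite /= mulrnAr -exprS mulrnAr polyCMn mulrnAl.
Qed.

Lemma Vind_ly (P : V -> Prop) :
  (forall k u v, P u -> P v -> P (k%:P%:P * u + v)) -> P 1 ->
  (forall v, P v -> P (x * v)) -> (forall v, P v -> P (ly h v)) -> forall v, P v.
Proof.
move=> Plin P1 Px Py.
have P0 : P 0.
  by rewrite -[0](_ : (-1)%:P%:P * 1 + 1 = 0); [exact: Plin|rewrite !rmorphN /= mulN1r addNr].
have Pc (q : {poly F}) u v : P u -> P v -> P (q%:P * u + v).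
  move=> Pu Pv; rewrite polyCC_coef mulr_suml.
  elim: (size _) => [|n IHn]; first by rewrite big_ord0 add0r.
  rewrite big_ord_recr /= -addrA addrCA -mulrA; apply: Plin => //.
  by elim: n {IHn} => [|n IHn]; rewrite ?mul1r // exprS -mulrA; apply: Px.
apply: Vind => //; elim=> [//|j IHj].
have -> : 'X^(j.+1) = (- (h^`() *+ j))%:P * 'X^j + ly h 'X^j.
  by rewrite ly_Xn rmorphN mulNr addKr.
by apply: Pc => //; apply: Py.
Qed.

Variable W : lmodType F.
Definition vlin (Phi : V -> W) := forall k u v, Phi (k%:P%:P * u + v) = k *: Phi u + Phi v.

Section Vlin.
Variables (Phi : V -> W) (L : vlin Phi).
Lemma vlinD u v : Phi (u + v) = Phi u + Phi v.
Proof. by have := L 1 u v; rewrite !mul1r scale1r. Qed.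
Lemma vlin0 : Phi 0 = 0.
Proof. by apply: (addrI (Phi 0)); rewrite -vlinD !addr0. Qed.
Lemma vlinZ k v : Phi (k%:P%:P * v) = k *: Phi v.
Proof. by rewrite -[_ * v]addr0 L vlin0 addr0. Qed.
Lemma vlinN v : Phi (- v) = - Phi v.
Proof. by apply: (addrI (Phi v)); rewrite -vlinD !subrr vlin0. Qed.
Lemma vlinB u v : Phi (u - v) = Phi u - Phi v.
Proof. by rewrite vlinD vlinN. Qed.
Lemma vlin_sum n (f : nat -> V) : Phi (\sum_(i < n) f i) = \sum_(i < n) Phi (f i).
Proof. by elim: n => [|n IHn]; rewrite ?big_ord0 ?vlin0 // !big_ord_recr vlinD IHn. Qed.
End Vlin.

Definition opoly (q : {poly F}) (X : W -> W) (w : W) : W :=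
  polysum (fun i c => c *: iter i X w) q.

Lemma vlin_opoly Phi (X : W -> W) q v : vlin Phi ->
  (forall v, Phi (x * v) = X (Phi v)) -> Phi (q%:P * v) = opoly q X (Phi v).
Proof.
move=> L PX; rewrite polyCC_coef mulr_suml.
rewrite (vlin_sum L _ (fun i => (q`_i)%:P%:P * x ^+ i * v)); apply: eq_bigr => i _.
rewrite -mulrA (vlinZ L); congr (_ *: _).
by elim: (i : nat) => [|n IHn]; rewrite ?mul1r // exprS -mulrA PX IHn.
Qed.

Lemma Rext (X : {linear W -> W}) (e : nat -> W) : exists Phi, [/\ vlin Phi,
  forall v, Phi (x * v) = X (Phi v) & forall j, Phi 'X^j = e j].
Proof.
pose T j (q : {poly F}) := opoly q X (e j).
have opolyL j k q r : T j (k%:P * q + r) = k *: T j q + T j r.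
  rewrite /T /opoly polysumD; first last.
  - by move=> *; rewrite scalerDl.
  - by move=> *; rewrite scale0r.
  congr (_ + _); rewrite (@polysum_widen _ _ _ _ (size q)) //; first last.
  - by rewrite mul_polyC size_scale_leq.
  - by move=> *; rewrite scale0r.
  by rewrite scaler_sumr; apply: eq_bigr => i _; rewrite coefCM scalerA.
have T0 j : T j 0 = 0 by rewrite /T /opoly /polysum size_poly0 big_ord0.
have TD j q r : T j (q + r) = T j q + T j r.
  by have := opolyL j 1 q r; rewrite mul1r scale1r.
exists (polysum T); split.
- move=> k u v; rewrite polysumD //; congr (_ + _).
  rewrite (@polysum_widen _ _ _ T0 (size u)) ?mul_polyC ?size_scale_leq // scaler_sumr.
  apply: eq_bigr => i _; rewrite coefZ -[_ * _]addr0 opolyL T0 addr0 //.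
- move=> v; rewrite (@polysum_widen _ _ _ T0 (size v)); last first.
    by rewrite mul_polyC size_scale_leq.
  rewrite linear_sum; apply: eq_bigr => j _; rewrite coefCM /T /opoly.
  rewrite (@polysum_widen _ _ _ _ (size v`_j).+1); first last.
  - by rewrite (leq_trans (size_polyMleq _ _)) // size_polyX.
  - by move=> *; rewrite scale0r.
  rewrite big_ord_recl coefXM eqxx scale0r add0r linear_sum.
  by apply: eq_bigr => i _; rewrite coefXM /= linearZ.
- move=> j; rewrite polysumXn // /T /opoly -[1](expr0 'X) polysumXn ?scale1r //.
  by move=> *; rewrite scale0r.
Qed.

(** F[x][xi] is the free left module on one generator: xi^(j+1) must go to Y - j h'(X) applied to
    the image of xi^j, and the relation makes the resulting map intertwine [ly h] with Y. The maps
    in [presented_basis], [cochain_ext] and [deformation_cocycle] arise in this way. *)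
Lemma Vext (X Y : {linear W -> W}) (w0 : W) :
  (forall w, Y (X w) - X (Y w) = opoly h X w) -> exists Phi, [/\ vlin Phi,
  Phi 1 = w0, forall v, Phi (x * v) = X (Phi v) & forall v, Phi (ly h v) = Y (Phi v)].
Proof.
move=> rel; pose e := fix e j := if j is j'.+1
  then Y (e j') - opoly (h^`() *+ j') X (e j') else w0.
have [Phi [L PX Pe]] := Rext X e; exists Phi; split=> //; first by rewrite -[1](expr0 'X) Pe.
apply: Vind => [k u v Pu Pv||v Pv|j].
- by rewrite lyD lyC !L linearP Pu Pv.
- by rewrite /ly dx0 deriv0 !mulr0 !addr0 vlin0 // linear0.
- rewrite ly_polyC derivX mulr1 (vlinD L) !PX Pv.
  by rewrite (vlin_opoly _ _ L PX) -rel addrCA subrr addr0.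
- by rewrite ly_Xn (vlinD L) (vlin_opoly _ _ L PX) !Pe addrCA subrr addr0.
Qed.
End Ext.

(** * The basis of the presented algebra *)

Section VEnd.
Variable F : fieldType.
Local Notation V := {poly {poly F}}.

(* F-linear endomorphisms of F[x][xi], which is not canonically an F-module. *)
Record vend : Type := VEnd {
  vfun :> V -> V;
  vfunP : forall (k : F) u v, vfun (k%:P%:P * u + v) = k%:P%:P * vfun u + vfun v }.

Lemma vendE (f g : vend) : (forall v, f v = g v) -> f = g.
Proof.
case: f g => f fP [g gP] /= fg; have E : f = g by apply/funext.
by subst g; congr VEnd; apply: Prop_irrelevance.
Qed.

HB.instance Definition _ := gen_eqMixin vend.
HB.instance Definition _ := gen_choiceMixin vend.

Lemma vendD (f : vend) u v : f (u + v) = f u + f v.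
Proof. by have := vfunP f 1 u v; rewrite !mul1r. Qed.
Lemma vend0 (f : vend) : f 0 = 0.
Proof. by apply: (addrI (f 0)); rewrite -vendD !addr0. Qed.
Lemma vendZ (f : vend) k v : f (k%:P%:P * v) = k%:P%:P * f v.
Proof. by rewrite -[_ * v]addr0 vfunP vend0 addr0. Qed.

Program Definition vend_zero := @VEnd (fun=> 0) _.
Next Obligation. by rewrite mulr0 addr0. Qed.
Program Definition vend_add (f g : vend) := @VEnd (fun v => f v + g v) _.
Next Obligation. by rewrite !vfunP; ring. Qed.
Program Definition vend_opp (f : vend) := @VEnd (fun v => - f v) _.
Next Obligation. by rewrite !vfunP; ring. Qed.
Program Definition vend_one := @VEnd id _.
Program Definition vend_mul (f g : vend) := @VEnd (fun v => f (g v)) _.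
Next Obligation. by rewrite !vfunP. Qed.
Program Definition vend_scale (k : F) (f : vend) := @VEnd (fun v => k%:P%:P * f v) _.
Next Obligation. by rewrite !vfunP; ring. Qed.

Fact vend_addA : associative vend_add.
Proof. by move=> f g k; apply: vendE => v /=; rewrite addrA. Qed.
Fact vend_addC : commutative vend_add.
Proof. by move=> f g; apply: vendE => v /=; rewrite addrC. Qed.
Fact vend_add0 : left_id vend_zero vend_add.
Proof. by move=> f; apply: vendE => v /=; rewrite add0r. Qed.
Fact vend_addN : left_inverse vend_zero vend_opp vend_add.
Proof. by move=> f; apply: vendE => v /=; rewrite addNr. Qed.
HB.instance Definition _ := GRing.isZmodule.Build vend
  vend_addA vend_addC vend_add0 vend_addN.

Fact vend_mulA : associative vend_mul. Proof. by move=> f g k; apply: vendE. Qed.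
Fact vend_mul1 : left_id vend_one vend_mul. Proof. by move=> f; apply: vendE. Qed.
Fact vend_mulr1 : right_id vend_one vend_mul. Proof. by move=> f; apply: vendE. Qed.
Fact vend_mulDl : left_distributive vend_mul vend_add.
Proof. by move=> f g k; apply: vendE. Qed.
Fact vend_mulDr : right_distributive vend_mul vend_add.
Proof. by move=> f g k; apply: vendE => v /=; rewrite vendD. Qed.
Fact vend_one_neq0 : vend_one != 0.
Proof.
apply/eqP => /(congr1 (fun f : vend => f 1)) /= /eqP.
by rewrite oner_eq0.
Qed.
HB.instance Definition _ := GRing.Zmodule_isNzRing.Build vend
  vend_mulA vend_mul1 vend_mulr1 vend_mulDl vend_mulDr vend_one_neq0.

Fact vend_scaleA k l f : vend_scale k (vend_scale l f) = vend_scale (k * l) f.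
Proof. by apply: vendE => v /=; rewrite mulrA -!rmorphM. Qed.
Fact vend_scale1 : left_id 1 vend_scale.
Proof. by move=> f; apply: vendE => v /=; rewrite mul1r. Qed.
Fact vend_scaleDr : right_distributive vend_scale +%R.
Proof. by move=> k f g; apply: vendE => v /=; rewrite mulrDr. Qed.
Fact vend_scaleDl f : {morph vend_scale^~ f : k l / k + l}.
Proof. by move=> k l; apply: vendE => v /=; rewrite !rmorphD mulrDl. Qed.
HB.instance Definition _ := GRing.Zmodule_isLmodule.Build F vend
  vend_scaleA vend_scale1 vend_scaleDr vend_scaleDl.

Fact vend_scaleAl (k : F) (f g : vend) : k *: (f * g) = k *: f * g.
Proof. exact: vendE. Qed.
HB.instance Definition _ := GRing.Lmodule_isLalgebra.Build F vend vend_scaleAl.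
Fact vend_scaleAr (k : F) (f g : vend) : k *: (f * g) = f * (k *: g).
Proof. by apply: vendE => v /=; rewrite vendZ. Qed.
HB.instance Definition _ := GRing.Lalgebra_isAlgebra.Build F vend vend_scaleAr.

Variable h : {poly F}.

Program Definition vend_x : vend := @VEnd (fun v => 'X%:P * v) _.
Next Obligation. ring. Qed.
Program Definition vend_y : vend := @VEnd (ly h) _.
Next Obligation. by rewrite lyD lyC. Qed.

Lemma vend_horner (q : {poly F}) v : (horner_alg vend_x q : vend) v = q%:P * v.
Proof.
elim/poly_ind: q v => [|q c IHq] v; first by rewrite rmorph0 polyC0 mul0r.
rewrite rmorphD rmorphM /= horner_algX horner_algC rmorphD rmorphM /=.
by rewrite -[LHS]/((horner_alg vend_x q : vend) ('X%:P * v) + c%:P%:P * v) IHq; ring.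
Qed.

Lemma vend_rel : vend_y * vend_x - vend_x * vend_y = horner_alg vend_x h.
Proof.
apply: vendE => v; rewrite vend_horner.
rewrite -[LHS]/(ly h ('X%:P * v) - 'X%:P * ly h v) ly_polyC derivX; ring.
Qed.
End VEnd.

Section SubAlg.
Variables (F : fieldType) (A : algType F) (P : A -> Prop).
Hypotheses (P1 : P 1) (Plin : forall k a b, P a -> P b -> P (k *: a + b)).
Hypothesis Pm : forall a b, P a -> P b -> P (a * b).

Let S : {pred A} := [pred a | `[< P a >]].
Let S_closed : GRing.subalg_closed S.
Proof.
split; first by apply/asboolP.
- by move=> k a b /asboolP Pa /asboolP Pb; apply/asboolP/Plin.
- by move=> a b /asboolP Pa /asboolP Pb; apply/asboolP/Pm.
Qed.
Let B : Type := {a : A | S a}.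
HB.instance Definition _ := SubChoice.on B.
HB.instance Definition _ := GRing.SubChoice_isSubAlgebra.Build F A S B
  (GRing.subalg_closed_semi S_closed).

(** The composite A -> B -> A through the subalgebra B cut out by [P] fixes x and y, so by
    uniqueness it is the identity and every element lies in B. *)
Lemma presented_ind (h : {poly F}) (x y : A) :
  presented_Ah h x y -> P x -> P y -> forall a, P a.
Proof.
move=> [rel univ] Px Py a.
pose b : B := exist _ x (asboolT Px); pose c : B := exist _ y (asboolT Py).
have val_horner (q : {poly F}) : val (horner_alg b q) = horner_alg x q.
  elim/poly_ind: q => [|q k IHq]; first by rewrite !rmorph0.
  by rewrite !rmorphD !rmorphM /= !horner_algX !horner_algC IHq.
have relB : c * b - b * c = horner_alg b h.
  by apply: val_inj; rewrite val_horner -rel rmorphB !rmorphM.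
have [f [fx fy _]] := univ B b c relB.
pose g a' : A := val (f a').
have gL : linear g by move=> k u v; rewrite /g linearP.
have gM : monoid_morphism g by split=> [|u v]; rewrite /g ?rmorph1 ?rmorphM.
pose gf : {lrmorphism A -> A} :=
  HB.pack g (GRing.isLinear.Build F A A *:%R g gL) (GRing.isMonoidMorphism.Build A A g gM).
have [f0 [_ _ uniq]] := univ A x y rel.
have -> : a = val (f a).
  by rewrite -[LHS]/(idfun a) (uniq idfun) // -(uniq gf) //= /g ?fx ?fy.
exact: asboolW (valP (f a)).
Qed.
End SubAlg.

Section Iso.
Variables (F : fieldType) (h : {poly F}) (A : algType F) (x y : A).
Local Notation V := {poly {poly F}}.

Lemma opoly_horner (q : {poly F}) (X : A -> A) a : (forall b, X b = x * b) ->
  opoly q X a = horner_alg x q * a.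
Proof.
move=> XE; rewrite -[in RHS](coefK q) poly_def rmorph_sum mulr_suml.
apply: eq_bigr => i _.
rewrite /= -mul_polyC rmorphM rmorphXn /= horner_algC horner_algX mulr_algl -scalerAl.
congr (_ *: _); elim: (i : nat) => [|n IHn]; first by rewrite mul1r.
by rewrite iterS XE IHn exprS mulrA.
Qed.

Definition lin_of (W : lmodType F) (f : W -> W) (fP : linear f) : {linear W -> W} :=
  HB.pack f (GRing.isLinear.Build F W W *:%R f fP).

(** A acts on F[x][xi] through [vend_x] and [vend_y], and a |-> rho a 1 inverts Phi on the left;
    generation by x and y makes Phi onto. *)
Lemma presented_basis : presented_Ah h x y ->
  exists Phi : V -> A, [/\ vlin Phi, bijective Phi, Phi 1 = 1,
  forall v, Phi ('X%:P * v) = x * Phi v & forall v, Phi (ly h v) = y * Phi v].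
Proof.
move=> hA; have [rel univ] := hA.
have rel' w : y * (x * w) - x * (y * w) = opoly h ( *%R x) w.
  by rewrite opoly_horner // -rel mulrBl !mulrA.
have lmul a : linear ( *%R a : A -> A) by move=> k b c; rewrite mulrDr scalerAr.
have [Phi [L P1 Px Py]] := @Vext F h A (lin_of (lmul x)) (lin_of (lmul y)) 1 rel'.
have {}Px v : Phi ('X%:P * v) = x * Phi v by exact: Px.
have {}Py v : Phi (ly h v) = y * Phi v by exact: Py.
have [rho [rx_ ry_ _]] := univ _ _ _ (vend_rel h).
have rhoK v : rho (Phi v) 1 = v.
  elim/(Vind_ly (h := h)): v => [k u v Pu Pv||v Pv|v Pv].
  - rewrite L linearP /= -[LHS]/(k%:P%:P * (rho (Phi u) 1) + rho (Phi v) 1).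
    by rewrite Pu Pv.
  - by rewrite P1 rmorph1.
  - by rewrite Px rmorphM /= rx_ -[LHS]/('X%:P * (rho (Phi v) 1)) Pv.
  - by rewrite Py rmorphM /= ry_ -[LHS]/(ly h (rho (Phi v) 1)) Pv.
have Psurj a : exists v, Phi v = a.
  apply: (presented_ind (P := fun a => exists v, Phi v = a) _ _ _ hA _ _ a)
    => [|k b c [u <-] [v <-]|b c [u <-] [v <-]||].
  - by exists 1.
  - by exists (k%:P%:P * u + v); rewrite L.
  - elim/(Vind_ly (h := h)): u => [k u w [u' Pu] [w' Pw]||u [u' Pu]|u [u' Pu]].
    + by exists (k%:P%:P * u' + w'); rewrite !L mulrDl -scalerAl Pu Pw.
    + by exists v; rewrite P1 mul1r.
    + by exists ('X%:P * u'); rewrite !Px Pu mulrA.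
    + by exists (ly h u'); rewrite !Py Pu mulrA.
  - by exists ('X%:P * 1); rewrite Px P1 mulr1.
  - by exists (ly h 1); rewrite Py P1 mulr1.
exists Phi; split=> //; exists (fun a => rho a 1) => // a.
by have [v <-] := Psurj a; rewrite rhoK.
Qed.
End Iso.

(** * Hochschild cochains *)

(* The square-zero extension Z + M of an abelian group M: through it the
   commutative [ring] tactic proves identities in the group M. *)
Section SquareZero.
Variable M : zmodType.
Definition sqz : Type := (int * M)%type.
HB.instance Definition _ := GRing.Zmodule.on sqz.
Definition sqz_mul (a b : sqz) : sqz := (a.1 * b.1, b.2 *~ a.1 + a.2 *~ b.1).
Fact sqz_mulA : associative sqz_mul.
Proof.
move=> [a m] [b n] [c k]; rewrite /sqz_mul /= mulrA !mulrzDl -!mulrzA addrA.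
by rewrite [b * a]mulrC [c * a]mulrC.
Qed.
Fact sqz_mulC : commutative sqz_mul.
Proof. by move=> a b; rewrite /sqz_mul mulrC addrC. Qed.
Fact sqz_mul1 : left_id ((1, 0) : sqz) sqz_mul.
Proof. by move=> [a m]; rewrite /sqz_mul /= mul1r mulr1z mul0rz addr0. Qed.
Fact sqz_mulDl : left_distributive sqz_mul +%R.
Proof.
move=> [a m] [b n] [c k]; rewrite /sqz_mul /= mulrDl mulrzDr mulrzDl.
by congr (_, _); rewrite addrACA.
Qed.
Fact sqz_one : ((1, 0) : sqz) != 0. Proof. by []. Qed.
HB.instance Definition _ := GRing.Zmodule_isComNzRing.Build sqz
  sqz_mulA sqz_mulC sqz_mul1 sqz_mulDl sqz_one.

Definition sqz_in (m : M) : sqz := (0, m).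
Lemma sqz_inj m n : sqz_in m = sqz_in n -> m = n. Proof. by case. Qed.
Lemma sqz_inD m n : sqz_in (m + n) = sqz_in m + sqz_in n. Proof. by []. Qed.
Lemma sqz_inN m : sqz_in (- m) = - sqz_in m. Proof. by []. Qed.
Lemma sqz_in0 : sqz_in 0 = 0. Proof. by []. Qed.
Definition sqz_inE := (sqz_inD, sqz_inN, sqz_in0).
End SquareZero.

Ltac abel := apply: sqz_inj; rewrite !sqz_inE; ring.

Section Cochains.
Variables (F : fieldType) (A : algType F).
Implicit Types (f g m : seq A -> A) (a b c : A) (s : seq A) (k : F).

(* The right action of A on k-cochains for which an (n + k)-cocycle becomes an
   n-cocycle with values in k-cochains; k is the length of s. *)
Fixpoint ract_rec s m b : A :=
  if s is c :: s' then m (b * c :: s') - ract_rec s' (fun t => m (b :: t)) c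
  else m [::] * b.
Definition ract m b s := ract_rec s m b.
Arguments ract : simpl never.

Lemma ract_nil m b : ract m b [::] = m [::] * b. Proof. by []. Qed.
Lemma ract_cons m b c s :
  ract m b (c :: s) = m (b * c :: s) - ract (fun t => m (b :: t)) c s.
Proof. by []. Qed.

(** All terms of the differential but the first make up the right action, so a cocycle is a cochain
    on which each element acts alike from both sides. *)
Lemma hdiffE n f a s : size s = n -> hdiff n f (a :: s) = a * f s - ract f a s.
Proof.
elim: s n f a => [|c s IHs] [|n] f a //= => [_|[sn]].
  by rewrite /hdiff big_ord0 /= addr0 expr1 mulN1r.
have := IHs n (fun t => f (a :: t)) c sn.
rewrite ract_cons /hdiff big_ord_recl /= expr1 mulN1r /= ?drop0.
rewrite [(-1) ^+ n.+2]exprS mulN1r mulNr.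
under [in X in _ -> X]eq_bigr => i _ do rewrite exprS mulN1r mulNr.
rewrite sumrN /=.
set S := (X in c * f (a :: s) + X + _).
rewrite [X in - f (a * c :: s) - X](_ : _ = S); last by apply: eq_bigr.
move: S (_ * (_ * _)) => S l E.
have -> : ract (fun t => f (a :: t)) c s =
    c * f (a :: s) - (c * f (a :: s) + S + l) by rewrite E; abel.
abel.
Qed.

Lemma eq_ract_size m m' b s : (forall t, size t = size s -> m t = m' t) ->
  ract m b s = ract m' b s.
Proof.
elim: s m m' b => [|c s IHs] m m' b mm'; first by rewrite !ract_nil mm'.
by rewrite !ract_cons mm' //; congr (_ - _); apply: IHs => t ts; rewrite mm' //= ts.
Qed.

Lemma eq_ract m m' : m =1 m' -> forall b s, ract m b s = ract m' b s.
Proof. by move=> mm' b s; apply: eq_ract_size. Qed.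

Lemma ractP a m m' b s :
  ract (fun t => a * m t + m' t) b s = a * ract m b s + ract m' b s.
Proof.
elim: s m m' b => [|c s IHs] m m' b; first by rewrite !ract_nil mulrDl mulrA.
by rewrite !ract_cons IHs mulrBr; abel.
Qed.

Lemma ractD m m' b s : ract (fun t => m t + m' t) b s = ract m b s + ract m' b s.
Proof.
rewrite -[ract m b s]mul1r -ractP; apply: eq_ract => t; by rewrite mul1r.
Qed.

Lemma ract0 b s : ract (fun=> 0) b s = 0.
Proof. by apply: (addrI (ract (fun=> 0) b s)); rewrite -ractD; rewrite !addr0. Qed.

Lemma ractM a m b s : ract (fun t => a * m t) b s = a * ract m b s.
Proof.
by rewrite -[RHS]addr0 -(ract0 b s) -ractP; apply: eq_ract => t; rewrite addr0.
Qed.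

Lemma ractN m b s : ract (fun t => - m t) b s = - ract m b s.
Proof. by rewrite -mulN1r -ractM; apply: eq_ract => t; rewrite mulN1r. Qed.

Lemma ractB m m' b s : ract (fun t => m t - m' t) b s = ract m b s - ract m' b s.
Proof. by rewrite ractD ractN. Qed.

Lemma ractZ k m b s : ract (fun t => k *: m t) b s = k *: ract m b s.
Proof. by rewrite -mulr_algl -ractM; apply: eq_ract => t; rewrite mulr_algl. Qed.

Lemma ract_sum n (m : nat -> seq A -> A) b s :
  ract (fun t => \sum_(i < n) m i t) b s = \sum_(i < n) ract (m i) b s.
Proof.
elim: n => [|n IHn].
  by rewrite big_ord0 -[RHS](ract0 b s); apply: eq_ract => t; rewrite big_ord0.
rewrite big_ord_recr /= -IHn -ractD; apply: eq_ract => t; by rewrite big_ord_recr.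
Qed.

(** This is an action, but 1 need not act as the identity: at c :: s it subtracts
    [ract (fun t => m (1 :: t)) c s]. The obstruction is therefore asked to vanish only after
    [ract]. *)
Lemma ractA m b c s : ract (ract m b) c s = ract m (b * c) s.
Proof.
elim: s m b c => [|d s IHs] m b c; first by rewrite !ract_nil mulrA.
rewrite !ract_cons mulrA.
rewrite -IHs -[X in _ - _ - X]/(ract
  (fun t => m (b * c :: t) - ract (fun t => m (b :: t)) c t) d s).
by rewrite ractB; abel.
Qed.

(** Multilinearity by recursion on the first argument, to match the recursion of [ract]. *)
Fixpoint mlin n f : Prop := if n is n'.+1 then
    (forall k a b s, size s = n' -> f (k *: a + b :: s) = k *: f (a :: s) + f (b :: s))
    /\ (forall a, mlin n' (fun t => f (a :: t)))
  else True.

Lemma multilinearP n f : multilinear n f <-> mlin n f.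
Proof.
elim: n f => [|n IHn] f; first by split=> // _ s [].
split=> [fL|[f0 fS] [|c s] [|i] k a b //= [sn]].
- split=> [k a b s sn|a]; first by have := fL (0 :: s) 0 k a b; rewrite /= sn; apply.
  apply/IHn => s i k b c sn ii.
  by have := fL (a :: s) i.+1 k b c; rewrite /= sn; apply.
- by move=> _; apply: f0.
- by rewrite ltnS => ii; have /IHn := fS c; apply.
Qed.

Lemma eq_mlin n f g : (forall s, size s = n -> f s = g s) -> mlin n f -> mlin n g.
Proof.
elim: n f g => // n IHn f g fg [f0 fS]; split=> [k a b s sn|a].
  by rewrite -!fg /= ?sn // f0.
by apply: IHn (fS a) => s sn; apply: fg; rewrite /= sn.
Qed.

Lemma mlinD n f g : mlin n f -> mlin n g -> mlin n (fun t => f t + g t).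
Proof.
elim: n f g => // n IHn f g [f0 fS] [g0 gS]; split=> [k a b s sn|a].
  by rewrite f0 // g0 // scalerDr; abel.
exact: IHn (fS a) (gS a).
Qed.

Lemma mlinM n a f : mlin n f -> mlin n (fun t => a * f t).
Proof.
elim: n f => // n IHn f [f0 fS]; split=> [k b c s sn|b]; last exact: IHn (fS b).
by rewrite f0 // mulrDr scalerAr.
Qed.

Lemma mlinN n f : mlin n f -> mlin n (fun t => - f t).
Proof. by move=> /(mlinM (-1)); apply: eq_mlin => s _; rewrite mulN1r. Qed.

Lemma mlinZ n k f : mlin n f -> mlin n (fun t => k *: f t).
Proof. by move=> /(mlinM k%:A); apply: eq_mlin => s _; rewrite mulr_algl. Qed.

Lemma mlin0 n : mlin n (fun=> 0).
Proof. by elim: n => // n IHn; split=> // *; rewrite scaler0 addr0. Qed.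

Lemma mlin_sum n l (f : nat -> seq A -> A) : (forall i, mlin n (f i)) ->
  mlin n (fun t => \sum_(i < l) f i t).
Proof.
move=> fL; elim: l => [|l IHl].
  by apply: eq_mlin (mlin0 n) => s _; rewrite big_ord0.
apply: eq_mlin (mlinD IHl (fL l)) => s _; by rewrite big_ord_recr.
Qed.

Lemma ract_lin n m k b c s : mlin n m -> size s = n ->
  ract m (k *: b + c) s = k *: ract m b s + ract m c s.
Proof.
elim: s n m b c => [|d s IHs] [|n] m b c //=; first by rewrite !ract_nil mulrDr scalerAr.
move=> [m0 mS] [sn]; rewrite !ract_cons mulrDl -scalerAl m0 //.
rewrite (eq_ract_size (m' := fun t => k *: m (b :: t) + m (c :: t))); last first.
  by move=> t; rewrite sn => /m0.
by rewrite ractD ractZ scalerBr; abel.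
Qed.

Lemma mlin_ract n m b : mlin n m -> mlin n (ract m b).
Proof.
elim: n m b => // n IHn m b [m0 mS]; split=> [k c d s sn|c].
  rewrite !ract_cons mulrDr -scalerAr m0 // (ract_lin _ _ _ (mS b) sn).
  by rewrite scalerBr; abel.
by apply: eq_mlin (mlinD (mS (b * c)) (mlinN (IHn _ c (mS b)))).
Qed.
End Cochains.
#[global] Arguments ract : simpl never.

(** * The obstruction class *)

Lemma sum_pair (F : fieldType) (U W : lmodType F) n (c : nat -> F) (X : nat -> U) (Y : nat -> W) :
  \sum_(i < n) c i *: (X i, Y i) = (\sum_(i < n) c i *: X i, \sum_(i < n) c i *: Y i).
Proof. by elim: n => [|n IHn]; rewrite ?big_ord0 // !big_ord_recr IHn. Qed.

Section Obstruction.
Variables (F : fieldType) (h : {poly F}) (A : algType F) (x y : A).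
Implicit Types (f u v : seq A -> A) (a b c q : A) (s : seq A).

(* [lop f s a m] is left multiplication by (a, m), evaluated at s, in the
   square-zero extension of A by k-cochains with factor set f. [obs_pow f u n] is
   the cochain component of (x, u)^n there, and [obs f u v] that of
   (y, v) (x, u) - (x, u) (y, v) - h(x, u). *)
Fixpoint obs_pow f u n s : A := if n is n'.+1
  then x * obs_pow f u n' s + ract u (x ^+ n') s + f [:: x, x ^+ n' & s]
  else - f [:: 1, 1 & s].

Definition obs f u v s : A :=
  y * u s + ract v x s + f [:: y, x & s]
  - (x * v s + ract u y s + f [:: x, y & s])
  - \sum_(i < size h) h`_i *: obs_pow f u i s.

Definition cocyc k f := forall a b c s, size s = k ->
  a * f [:: b, c & s] - f [:: a * b, c & s] + f [:: a, b * c & s] =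
  ract (fun t => f [:: a, b & t]) c s.

Definition lop f s a m (w : A * A) : A * A :=
  (a * w.1, a * w.2 + ract m w.1 s + f [:: a, w.1 & s]).

Lemma lop_lin k f s a m : mlin k.+2 f -> mlin k m -> size s = k -> linear (lop f s a m).
Proof.
move=> [_ fS] mL sk l [b q] [c r]; have [fa _] := fS a.
rewrite /lop /= (ract_lin _ _ _ mL sk) fa //; congr (_, _) => /=.
  by rewrite mulrDr scalerAr.
by rewrite mulrDr !scalerDr -!scalerAr; abel.
Qed.

Lemma lop_mul k f s a m b n : cocyc k f -> size s = k -> forall w,
  lop f s a m (lop f s b n w) =
  lop f s (a * b) (fun t => a * n t + ract m b t + f [:: a, b & t]) w.
Proof.
move=> fC sk [c q]; rewrite /lop /=; congr (_, _); first by rewrite mulrA.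
rewrite 2!ractD ractM ractA -fC // !mulrDr !mulrA; abel.
Qed.

(** Cocycles are not normalised: the left unit of the extension is (1, -f(1,1)), whence the value of
    [obs_pow] at 0. *)
Lemma lop1 k f s : cocyc k f -> size s = k -> forall w,
  lop f s 1 (fun t => - f [:: 1, 1 & t]) w = w.
Proof.
move=> fC sk [c q]; rewrite /lop /= ractN -fC // !mul1r; congr (_, _); abel.
Qed.

Lemma iter_lop k f u s n w : cocyc k f -> size s = k ->
  iter n (lop f s x u) w = lop f s (x ^+ n) (obs_pow f u n) w.
Proof.
move=> fC sk; elim: n => [|n IHn]; first by rewrite (lop1 fC).
by rewrite iterS IHn (lop_mul _ _ _ _ fC) // -exprS.
Qed.

Hypothesis rel : y * x - x * y = horner_alg x h.

Lemma horner_alg_sum (q : {poly F}) : horner_alg x q = \sum_(i < size q) q`_i *: x ^+ i.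
Proof.
have := @opoly_horner F A x q ( *%R x) 1 (fun=> erefl).
rewrite mulr1 => <-; apply: eq_bigr => i _; congr (_ *: _).
by elim: (i : nat) => [|n IHn]; rewrite ?expr0 // exprS -IHn.
Qed.

(** Both sides are left multiplications by lifts of yx - xy = h(x). The cochain components of the
    two lifts differ by [obs] up to the additivity defect of f, and enter only through their right
    translates by b. *)
Lemma lop_rel k f u v s : cocyc k f -> mlin k.+2 f -> size s = k ->
  (forall b, ract (obs f u v) b s = 0) -> forall w,
  lop f s y v (lop f s x u w) - lop f s x u (lop f s y v w) =
  opoly h (lop f s x u) w.
Proof.
move=> fC [f0 _] sk ob [b q].
rewrite !(lop_mul _ _ _ _ fC) // /opoly /polysum.
under eq_bigr => i _ do rewrite (iter_lop _ _ _ fC) //.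
rewrite /lop /=.
rewrite (sum_pair _ (fun i => h`_i) (fun i => x ^+ i * b)
  (fun i => x ^+ i * q + ract (obs_pow f u i) b s + f [:: x ^+ i, b & s])).
have f_h : f [:: y * x, b & s] - f [:: x * y, b & s] =
    \sum_(i < size h) h`_i *: f [:: x ^+ i, b & s].
  have sb : size (b :: s) = k.+1 by rewrite /= sk.
  have f00 : f [:: 0, b & s] = 0.
    have := f0 1 0 0 _ sb; rewrite !scale1r addr0 => E.
    by apply: (addrI (f [:: 0, b & s])); rewrite -E addr0.
  have fsum n (c : nat -> F) (X : nat -> A) :
    f [:: \sum_(i < n) c i *: X i, b & s] = \sum_(i < n) c i *: f [:: X i, b & s].
    elim: n => [|n IHn]; first by rewrite !big_ord0.
    by rewrite !big_ord_recr /= addrC f0 // IHn addrC.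
  rewrite -fsum -horner_alg_sum -rel addrC -scaleN1r -f0 //.
  by rewrite scaleN1r addrC.
have hb (c : A) : y * x * c - x * y * c = \sum_(i < size h) h`_i *: (x ^+ i * c).
  rewrite -mulrBl rel horner_alg_sum mulr_suml; apply: eq_bigr => i _.
  by rewrite scalerAl.
congr (_, _) => /=; first exact: hb.
have := ob b; rewrite /obs 2!ractB (ract_sum _ (fun i t => h`_i *: obs_pow f u i t)).
under [X in _ - X = _ -> _]eq_bigr => i _ do rewrite ractZ.
move=> E; under [RHS]eq_bigr => i _ do rewrite 2!scalerDr.
rewrite !big_split /= -hb -f_h.
set S := \sum_(i < _) _ in E *.
have -> : S = ract (fun t => y * u t + ract v x t + f [:: y, x & t]) b s
  - ract (fun t => x * v t + ract u y t + f [:: x, y & t]) b s.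
  by rewrite -[S]addr0 -E; abel.
abel.
Qed.
End Obstruction.

(** * Lifting the algebra into a square-zero extension from its generators *)

Section Basis.
Variables (F : fieldType) (h : {poly F}) (A : algType F) (x y : A).
Local Notation V := {poly {poly F}}.
Implicit Types (f u v : seq A -> A) (a b c q : A) (s : seq A) (w : V).
Hypothesis rel : y * x - x * y = horner_alg x h.
Variables (Phi : V -> A) (Psi : A -> V).
Hypotheses (L : vlin Phi) (PhiK : cancel Phi Psi) (PsiK : cancel Psi Phi) (Phi1 : Phi 1 = 1).
Hypotheses (PhiX : forall w, Phi ('X%:P * w) = x * Phi w)
  (PhiY : forall w, Phi (ly h w) = y * Phi w).

Lemma Aind (P : A -> Prop) :
  (forall k a b, P a -> P b -> P (k *: a + b)) -> P 1 ->
  (forall a, P a -> P (x * a)) -> (forall a, P a -> P (y * a)) -> forall a, P a.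
Proof.
move=> Plin P1 Px Py a; rewrite -[a]PsiK; move: (Psi a).
apply: (Vind_ly (h := h)) => [k w w' Pw Pw'||w Pw|w Pw].
- by rewrite L; apply: Plin.
- by rewrite Phi1.
- by rewrite PhiX; apply: Px.
- by rewrite PhiY; apply: Py.
Qed.

Lemma Psi_lin k a b : Psi (k *: a + b) = k%:P%:P * Psi a + Psi b.
Proof. by apply: (can_inj PhiK); rewrite L !PsiK. Qed.
Lemma Psi1 : Psi 1 = 1. Proof. by rewrite -Phi1 PhiK. Qed.
Lemma PsiX a : Psi (x * a) = 'X%:P * Psi a.
Proof. by apply: (can_inj PhiK); rewrite PhiX !PsiK. Qed.
Lemma PsiY a : Psi (y * a) = ly h (Psi a).
Proof. by apply: (can_inj PhiK); rewrite PhiY !PsiK. Qed.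

(** The lift sends a to (a, g a) and comes from letting (x, u) and (y, v) act. [Vext] on A x A gives
    it for each [s] separately, and multilinearity in [s] is recovered by induction on a. The values
    at x and y are those of the products of (x, u) and (y, v) with the left unit, which need not be
    a right unit. *)
Lemma cochain_ext k f u v : mlin k.+2 f -> cocyc k f -> mlin k u -> mlin k v ->
  (forall b s, size s = k -> ract (obs h x y f u v) b s = 0) ->
  exists g, [/\ mlin k.+1 g,
    forall a b s, size s = k ->
      g (a * b :: s) = a * g (b :: s) + ract (fun t => g (a :: t)) b s + f [:: a, b & s],
    forall s, size s = k -> g (x :: s) = ract u 1 s + f [:: x, 1 & s] - x * f [:: 1, 1 & s] &
    forall s, size s = k -> g (y :: s) = ract v 1 s + f [:: y, 1 & s] - y * f [:: 1, 1 & s]].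
Proof.
move=> fL fC uL vL ob; have [f0 fS] := fL.
pose good s (T : V -> A * A) := size s = k -> [/\ vlin T, T 1 = (1, 0),
  forall w, T ('X%:P * w) = lop f s x u (T w) & forall w, T (ly h w) = lop f s y v (T w)].
have [T Tgood] : {T : seq A -> V -> A * A & forall s, good s (T s)}.
  apply: choice => s; have [sk|nsk] := eqVneq (size s) k; last first.
    by exists (fun=> 0) => /eqP; rewrite (negPf nsk).
  have [T [TL T1 TX TY]] := @Vext F h _ (lin_of (lop_lin x fL uL sk))
    (lin_of (lop_lin y fL vL sk)) (1, 0) (lop_rel rel fC fL sk (fun b => ob b s sk)).
  by exists T.
pose t a s := (T s (Psi a)).2.
have T1 s (sk : size s = k) w : (T s w).1 = Phi w.
  have [TL To TX TY] := Tgood s sk; elim/(Vind_ly (h := h)): w => [l w w' Pw Pw'||w Pw|w Pw].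
  - by rewrite TL L -Pw -Pw'.
  - by rewrite To Phi1.
  - by rewrite TX PhiX -Pw.
  - by rewrite TY PhiY -Pw.
have tX a s : size s = k -> t (x * a) s = x * t a s + ract u a s + f [:: x, a & s].
  by move=> sk; have [TL To TX TY] := Tgood s sk; rewrite /t PsiX TX /lop /= T1 // PsiK.
have tY a s : size s = k -> t (y * a) s = y * t a s + ract v a s + f [:: y, a & s].
  by move=> sk; have [TL To TX TY] := Tgood s sk; rewrite /t PsiY TY /lop /= T1 // PsiK.
have t1 s : size s = k -> t 1 s = 0.
  by move=> sk; have [TL To TX TY] := Tgood s sk; rewrite /t Psi1 To.
have tlin l a b s : size s = k -> t (l *: a + b) s = l *: t a s + t b s.
  by move=> sk; have [TL To TX TY] := Tgood s sk; rewrite /t Psi_lin TL.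
have f_a a : mlin k.+1 (fun s => f (a :: s)) := fS a.
have f_ab a b : mlin k (fun s => f [:: a, b & s]) by case: (f_a a) => _ /(_ b).
have tL a : mlin k (t a).
  elim/Aind: a => [l a b ta tb||a ta|a ta].
  - by apply: eq_mlin (mlinD (mlinZ l ta) tb) => s sk; rewrite tlin.
  - by apply: eq_mlin (@mlin0 F A k) => s sk; rewrite t1.
  - by apply: eq_mlin (mlinD (mlinD (mlinM x ta) (mlin_ract a uL)) (f_ab x a)) => s sk; rewrite tX.
  - by apply: eq_mlin (mlinD (mlinD (mlinM y ta) (mlin_ract a vL)) (f_ab y a)) => s sk; rewrite tY.
(* [t] follows the orbit of (1, 0); subtracting a f(1,1) moves the starting point to the left unit
   (1, -f(1,1)), which makes a |-> (a, g a) multiplicative. *)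
pose g r := if r is a :: s then t a s - a * f [:: 1, 1 & s] else 0.
have gZ (z : A) m : (forall a s, size s = k ->
    t (z * a) s = z * t a s + ract m a s + f [:: z, a & s]) -> forall a s, size s = k ->
    g (z * a :: s) = z * g (a :: s) + ract m a s + f [:: z, a & s].
  by move=> tz a s sk; rewrite /g tz // mulrBr mulrA; abel.
have gX := gZ x u tX; have gY := gZ y v tY.
have g1 s : size s = k -> g (1 :: s) = - f [:: 1, 1 & s].
  by move=> sk; rewrite /g t1 // mul1r add0r.
have glin l a b s : size s = k -> g (l *: a + b :: s) = l *: g (a :: s) + g (b :: s).
  by move=> sk; rewrite /g tlin // mulrDl scalerBr -scalerAl; abel.
have gL : mlin k.+1 g.
  split=> [l a b s sk|a]; first exact: glin.
  exact: mlinD (tL a) (mlinN (mlinM a (f_ab 1 1))).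
clear gZ; clearbody g.
have step (z : A) m a : (forall a s, size s = k ->
    g (z * a :: s) = z * g (a :: s) + ract m a s + f [:: z, a & s]) ->
    (forall b s, size s = k -> g (a * b :: s) =
      a * g (b :: s) + ract (fun t => g (a :: t)) b s + f [:: a, b & s]) ->
    (forall b s, size s = k -> g (z * a * b :: s) =
      z * a * g (b :: s) + ract (fun t => g (z * a :: t)) b s + f [:: z * a, b & s]).
  move=> gz IH b s sk; rewrite -mulrA gz // IH //.
  rewrite (eq_ract_size (m := fun t => g (z * a :: t))
    (m' := fun t => z * g (a :: t) + ract m a t + f [:: z, a & t])); last first.
    by move=> r; rewrite sk => /gz.
  by rewrite 2!ractD ractM ractA -fC // !mulrDr !mulrA; abel.
exists g; split=> // [a||].
- elim/Aind: a => [l a b Pa Pb|c s sk|a Pa c s sk|a Pa c s sk].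
  + move=> c s sk; rewrite mulrDl -scalerAl glin // Pa // Pb // mulrDl -!scalerAl.
    rewrite (eq_ract_size (m := fun t => g (l *: a + b :: t))
      (m' := fun t => l *: g (a :: t) + g (b :: t))); last by move=> r; rewrite sk => /glin.
    by rewrite ractD ractZ f0 /= ?sk // !scalerDr; abel.
  + rewrite !mul1r (eq_ract_size (m := fun t => g (1 :: t))
      (m' := fun t => - f [:: 1, 1 & t])); last by move=> r; rewrite sk => /g1.
    by rewrite ractN -fC // !mul1r; abel.
  + exact: (step x u a gX Pa).
  + exact: (step y v a gY Pa).
- by move=> s sk; rewrite -[x in LHS]mulr1 gX // g1 // mulrN; abel.
- by move=> s sk; rewrite -[y in LHS]mulr1 gY // g1 // mulrN; abel.
Qed.
End Basis.

(** * Cocycles and coboundaries in a single degree *)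

Section Degree.
Variables (F : fieldType) (A : algType F).
Implicit Types (f g : seq A -> A).

Definition cocy n f := mlin n f /\ forall a s, size s = n -> a * f s = ract f a s.
Definition cobd n f := if n is m.+1
  then exists2 g, mlin m g & forall a s, size s = m -> f (a :: s) = a * g s - ract g a s
  else f [::] = 0.

Lemma cocyP k f : cocy k.+2 f <-> mlin k.+2 f /\ cocyc k f.
Proof.
split=> -[fL fC]; split=> //.
  move=> a b c s sk.
  by rewrite (fC a [:: b, c & s]) /= ?sk // 2!ract_cons; abel.
by move=> a [|b [|c s]] //= [sk]; rewrite 2!ract_cons -fC //; abel.
Qed.

Lemma cobd_eq n f g : (forall s, size s = n -> f s = g s) -> cobd n f -> cobd n g.
Proof.
case: n => [|n] fg; first by rewrite /= -fg.
by case=> e eL eE; exists e => // a s sn; rewrite -fg ?eE //= sn.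
Qed.

Lemma cobdD n f g : cobd n f -> cobd n g -> cobd n (fun s => f s + g s).
Proof.
case: n => [|n] /=; first by move=> -> ->; rewrite addr0.
move=> [e eL eE] [e' e'L e'E]; exists (fun t => e t + e' t); first exact: mlinD.
by move=> a s sn; rewrite eE // e'E // ractD mulrDr; abel.
Qed.

Lemma cobdM n z f : central z -> cobd n f -> cobd n (fun s => z * f s).
Proof.
move=> zc; case: n => [|n] /=; first by move=> ->; rewrite mulr0.
move=> [e eL eE]; exists (fun t => z * e t); first exact: mlinM.
by move=> a s sn; rewrite eE // ractM mulrBr !mulrA (zc a).
Qed.

Lemma cobdN n f : cobd n f -> cobd n (fun s => - f s).
Proof.
have c1 : central (-1 : A) by move=> a; rewrite mulN1r mulrN1.
by move=> /(cobdM c1); apply: cobd_eq => s _; rewrite mulN1r.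
Qed.

Lemma cobd0 n : cobd n (fun=> 0 : A).
Proof.
case: n => [|n] //=; exists (fun=> 0) => [|a s _]; first exact: mlin0.
by rewrite ract0 mulr0 subrr.
Qed.

Lemma cocyD n f g : cocy n f -> cocy n g -> cocy n (fun s => f s + g s).
Proof.
move=> [fL fC] [gL gC]; split; first exact: mlinD.
by move=> a s sn; rewrite ractD -fC // -gC // mulrDr.
Qed.

Lemma cocyM n z f : central z -> cocy n f -> cocy n (fun s => z * f s).
Proof.
move=> zc [fL fC]; split; first exact: mlinM.
by move=> a s sn; rewrite ractM -fC // !mulrA (zc a).
Qed.

Lemma cocyN n f : cocy n f -> cocy n (fun s => - f s).
Proof.
move=> [fL fC]; split; first exact: mlinN.
by move=> a s sn; rewrite ractN -fC // mulrN.
Qed.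

Lemma cocy0 n : cocy n (fun=> 0 : A).
Proof. by split=> [|a s _]; [exact: mlin0|rewrite ract0 mulr0]. Qed.

Lemma cocy1P f : cocy 1 f -> forall a b, f [:: a * b] = a * f [:: b] + f [:: a] * b.
Proof. by move=> [_ fC] a b; rewrite (fC a [:: b]) // ract_cons ract_nil subrK. Qed.

Lemma cocy1_1 f : cocy 1 f -> f [:: 1] = 0.
Proof.
move=> /cocy1P/(_ 1 1); rewrite !mulr1 mul1r => /eqP.
by rewrite -{1}[f _]addr0 (inj_eq (addrI _)) => /eqP.
Qed.
End Degree.

Section Obs.
Variables (F : fieldType) (h : {poly F}) (A : algType F) (x y : A).
Implicit Types (f u v : seq A -> A) (a b c q : A) (s : seq A).
Local Notation obs := (obs h x y).

Lemma obs_powD f f' u u' n s :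
  obs_pow x (fun t => f t + f' t) (fun t => u t + u' t) n s =
  obs_pow x f u n s + obs_pow x f' u' n s.
Proof.
elim: n => [|n IHn] /=; first by rewrite opprD.
by rewrite IHn ractD mulrDr; abel.
Qed.

Lemma obsD f f' u u' v v' s :
  obs (fun t => f t + f' t) (fun t => u t + u' t) (fun t => v t + v' t) s =
  obs f u v s + obs f' u' v' s.
Proof.
rewrite /obs !ractD !mulrDr.
under eq_bigr => i _ do rewrite obs_powD scalerDr.
by rewrite big_split /=; abel.
Qed.

Lemma obs_powM z f u n s : central z ->
  obs_pow x (fun t => z * f t) (fun t => z * u t) n s = z * obs_pow x f u n s.
Proof.
move=> zc; elim: n => [|n IHn] /=; first by rewrite mulrN.
by rewrite IHn ractM !mulrDr !mulrA -zc.
Qed.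

Lemma obsM z f u v s : central z ->
  obs (fun t => z * f t) (fun t => z * u t) (fun t => z * v t) s = z * obs f u v s.
Proof.
move=> zc; rewrite /obs !ractM !mulrBr !mulrDr !mulrA -!zc mulr_sumr.
congr (_ - _); apply: eq_bigr => i _.
by rewrite obs_powM // scalerAr.
Qed.

Lemma eq_obs f f' u u' v v' s : f =1 f' -> u =1 u' -> v =1 v' -> obs f u v s = obs f' u' v' s.
Proof. by move=> /funext-> /funext-> /funext->. Qed.

Lemma obs_split f u v s :
  obs f u v s = obs f (fun=> 0) (fun=> 0) s + obs (fun=> 0) u v s.
Proof. by rewrite -obsD; apply: eq_obs => t; rewrite ?addr0 ?add0r. Qed.

Lemma obs0v v s : obs (fun=> 0) (fun=> 0) v s = ract v x s - x * v s.
Proof.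
rewrite /obs big1 => [|i _]; first by rewrite !ract0 mulr0; abel.
suff -> : obs_pow x (fun=> 0) (fun=> 0) i s = 0 by rewrite scaler0.
by elim: (i : nat) => [|n IHn] /=; rewrite ?oppr0 // IHn ract0 mulr0 !addr0.
Qed.

Lemma mlin_obs_pow k f u n : mlin k.+2 f -> mlin k u -> mlin k (obs_pow x f u n).
Proof.
move=> [_ fS] uL; have fab a b : mlin k (fun t => f [:: a, b & t]).
  by case: (fS a) => _ /(_ b).
elim: n => [|n IHn] /=; first exact: mlinN.
exact: mlinD (mlinD (mlinM _ IHn) (mlin_ract _ uL)) (fab _ _).
Qed.

Lemma mlin_obs k f u v : mlin k.+2 f -> mlin k u -> mlin k v -> mlin k (obs f u v).
Proof.
move=> fL uL vL; have fab a b : mlin k (fun t => f [:: a, b & t]).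
  by case: fL => _ /(_ a)[_ /(_ b)].
apply: mlinD; last first.
  apply: mlinN; apply: (@mlin_sum _ _ k _ (fun i t => h`_i *: obs_pow x f u i t)) => i.
  exact/mlinZ/mlin_obs_pow.
apply: mlinD; first exact: mlinD (mlinD (mlinM _ uL) (mlin_ract _ vL)) (fab _ _).
apply: mlinN; exact: mlinD (mlinD (mlinM _ vL) (mlin_ract _ uL)) (fab _ _).
Qed.

Hypothesis rel : y * x - x * y = horner_alg x h.

(** a |-> (a, -g a) is a lift of A into the extension with factor set f, and a lift respects the
    defining relation. *)
Lemma obs_coboundary f g : mlin 1 g ->
  (forall a b, f [:: a; b] = a * g [:: b] - g [:: a * b] + g [:: a] * b) ->
  obs f (fun=> - g [:: x]) (fun=> - g [:: y]) [::] = 0.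
Proof.
move=> [g0 _] fE.
have pE n : obs_pow x f (fun=> - g [:: x]) n [::] = - g [:: x ^+ n].
  elim: n => [|n IHn] /=; first by rewrite fE !mul1r mulr1; abel.
  by rewrite IHn ract_nil fE -exprS mulrN mulNr; abel.
have gB a b : g [:: a - b] = g [:: a] - g [:: b].
  by have := g0 (-1) b a [::] erefl; rewrite !scaleN1r addrC => ->; rewrite addrC.
have g00 : g [:: 0] = 0 by have := gB 0 0; rewrite !subrr.
have gsum n (c : nat -> F) (X : nat -> A) :
    g [:: \sum_(i < n) c i *: X i] = \sum_(i < n) c i *: g [:: X i].
  elim: n => [|n IHn]; first by rewrite !big_ord0.
  by rewrite !big_ord_recr /= addrC g0 // IHn addrC.
rewrite /obs; under eq_bigr => i _ do rewrite pE scalerN.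
rewrite sumrN -gsum -(horner_alg_sum x h) -rel gB !ract_nil !fE !mulrN !mulNr; abel.
Qed.
End Obs.

(** * Hochschild cohomology of the presented algebra *)

Section Basis.
Variables (F : fieldType) (h : {poly F}) (A : algType F) (x y : A).
Local Notation V := {poly {poly F}}.
Local Notation obs := (obs h x y).
Implicit Types (f u v : seq A -> A) (a b c q z : A) (s : seq A) (w : V).
Hypothesis (hn0 : h != 0) (rel : y * x - x * y = horner_alg x h).
Variables (Phi : V -> A) (Psi : A -> V).
Hypotheses (L : vlin Phi) (PhiK : cancel Phi Psi) (PsiK : cancel Psi Phi) (Phi1 : Phi 1 = 1).
Hypotheses (PhiX : forall w, Phi ('X%:P * w) = x * Phi w)
  (PhiY : forall w, Phi (ly h w) = y * Phi w).

Let Aind := Aind L PsiK Phi1 PhiX PhiY.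
Let hPn0 : h%:P != 0 :> V. Proof. by rewrite polyC_eq0. Qed.

Lemma ly1 : ly h 1 = 'X.
Proof. by rewrite /ly dx1 derivC !mulr0 mulr1 !add0r. Qed.

Lemma Phi_y : Phi 'X = y.
Proof. by rewrite -ly1 PhiY Phi1 mulr1. Qed.

Lemma Phi_rx w : Phi (rx h w) = Phi w * x.
Proof.
have N := dlin_rx h.
elim/(Vind_ly (h := h)): w => [k u v Pu Pv||w Pw|w Pw].
- by rewrite (dlinD N) (dlinC N) !L mulrDl -scalerAl Pu Pv.
- by rewrite /rx derivC mulr0 addr0 PhiX Phi1 mulr1 mul1r.
- by rewrite (dlinC N) !PhiX Pw mulrA.
- by rewrite -ly_rx !PhiY Pw mulrA.
Qed.

Lemma Phi_ry w : Phi (ry h w) = Phi w * y.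
Proof.
have N := dlin_Ksum h.
have ryD (u v : V) : ry h (u + v) = ry h u + ry h v.
  by rewrite /ry (dlinD N) derivD; ring.
have ryC (c : {poly F}) (v : V) : ry h (c%:P * v) = c%:P * ry h v.
  by rewrite /ry (dlinC N) deriv_mulC; ring.
elim/(Vind_ly (h := h)): w => [k u v Pu Pv||w Pw|w Pw].
- by rewrite ryD ryC !L mulrDl -scalerAl Pu Pv.
- by rewrite /ry (dlinX N) derivC (dlin0 N) addr0 mulr1 Phi_y Phi1 mul1r.
- by rewrite ryC !PhiX Pw mulrA.
- by rewrite -ly_ry // !PhiY Pw mulrA.
Qed.

Lemma comm_x w : Phi w * x - x * Phi w = Phi (h%:P * w^`()).
Proof. by rewrite -Phi_rx -PhiX -(vlinB L); congr Phi; rewrite /rx; ring. Qed.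

Lemma comm_y w : w^`() = 0 -> y * Phi w - Phi w * y = Phi (h%:P * dx w).
Proof.
move=> w0; rewrite -Phi_ry -PhiY -(vlinB L); congr Phi.
by rewrite /ly /ry (dlinX (dlin_Ksum h)) w0 (dlin0 (dlin_Ksum h)); ring.
Qed.

Lemma Phi_inj : injective Phi. Proof. exact: can_inj PhiK. Qed.
Lemma Phi0 : Phi 0 = 0. Proof. exact: vlin0 L. Qed.

Lemma centralP w : central (Phi w) <-> const w.
Proof.
have h0 (u : V) : Phi (h%:P * u) = 0 -> u = 0.
  rewrite -Phi0 => /Phi_inj/eqP; rewrite mulf_eq0 (negPf hPn0) => /eqP //.
split=> [wc|[w0 w1] a].
  have w0 : w^`() = 0 by apply: h0; rewrite -comm_x wc subrr.
  by split=> //; apply: h0; rewrite -comm_y // wc subrr.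
elim/Aind: a => [k a b Ha Hb||a Ha|a Ha].
- by rewrite mulrDr mulrDl -scalerAr -scalerAl Ha Hb.
- by rewrite mulr1 mul1r.
- have /eqP := comm_x w; rewrite w0 mulr0 Phi0 subr_eq0 => /eqP E.
  by rewrite mulrA E -!mulrA Ha.
- have /eqP := comm_y w0; rewrite w1 mulr0 Phi0 subr_eq0 => /eqP E.
  by rewrite mulrA -E -!mulrA Ha.
Qed.

Lemma Phi_mul_const (v : V) w : const w -> Phi w * Phi v = Phi (w * v).
Proof.
move=> wc; have [w0 w1] := wc; have /centralP wz := wc.
rewrite wz [w * v]mulrC; elim/(Vind_ly (h := h)): v => [k u v Pu Pv||v Pv|v Pv].
- by rewrite !mulrDl L -mulrA L -Pu -Pv mulrDl -scalerAl.
- by rewrite Phi1 !mul1r.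
- by rewrite -mulrA !PhiX -mulrA Pv.
- rewrite PhiY -mulrA Pv -PhiY; congr Phi.
  by rewrite /ly dxM derivM w0 w1; ring.
Qed.

(** This is the origin of [d1]: the linearisation of yx - xy - h(x) in the direction (U, W), written
    in the model. *)
Lemma obs_d1 U W :
  obs (fun=> 0) (fun=> Phi U) (fun=> Phi W) [::] = Phi (d1 h U W).
Proof.
have pE n : obs_pow x (fun=> 0) (fun=> Phi U) n [::] = Phi (Kn h n U).
  elim: n => [|n IHn] /=; first by rewrite oppr0 Phi0.
  rewrite IHn ract_nil addr0 (vlinD L) PhiX; congr (_ + _).
  elim: n {IHn} => [|n IHn]; first by rewrite mulr1.
  by rewrite iterS Phi_rx -IHn exprSr mulrA.
rewrite /obs; under eq_bigr => i _ do rewrite pE -(vlinZ L).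
rewrite -(vlin_sum L _ (fun i => (h`_i)%:P%:P * Kn h i U)) -/(Ksum h U) !ract_nil.
rewrite -!Phi_rx -!Phi_ry -!PhiX -!PhiY !addr0 -!(vlinD L) -!(vlinB L); congr Phi.
by rewrite /d1 /Sop /ly /ry /rx derivM derivX; ring.
Qed.

(* The right action on an extra cochain variable is coinduced up to terms
   killed by the unit, so already [ad x] is onto and the obstruction vanishes. *)
Lemma cobd_ge3 k f : cocy k.+3 f -> cobd k.+3 f.
Proof.
move=> /cocyP[fL fC].
have [th thE] : {th | th = obs f (fun=> 0) (fun=> 0)} by exists (obs f (fun=> 0) (fun=> 0)).
have thL : mlin k.+1 th by rewrite thE; apply: mlin_obs => //; apply: mlin0.
have [th0 thS] := thL.
(* The second component is to be a cochain v with v(x a :: s) = x v(a :: s) - th(a :: s) and v = 0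
   on the xi^j. These form a basis over F[x], so no condition involving y arises. The obstruction
   then becomes [th - ract th 1], which every [ract] by b kills. *)
pose good s (T : V -> A * A) := [/\ vlin T, forall j, T 'X^j = (Phi 'X^j, 0) &
  forall w, T ('X%:P * w) = (x * (T w).1, x * (T w).2 - th ((T w).1 :: s))].
have [T Tgood] : {T : seq A -> V -> A * A & forall s, size s = k -> good s (T s)}.
  apply: (@choice _ _ (fun s T => size s = k -> good s T)) => s.
  have [sk|nsk] := eqVneq (size s) k; last first.
    by exists (fun=> 0) => /eqP; rewrite (negPf nsk).
  have X_lin : linear (fun w : A * A => (x * w.1, x * w.2 - th (w.1 :: s))).
    move=> l [a q] [b r]; rewrite /= th0 //; congr (_, _) => /=.
      by rewrite mulrDr scalerAr.
    by rewrite mulrDr scalerBr scalerAr; abel.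
  by have [T [TL TX Te]] := Rext (lin_of X_lin) (fun j => (Phi 'X^j, 0)); exists T.
pose v r := if r is c :: s then (T s (Psi c)).2 else 0.
have T1 s w : size s = k -> (T s w).1 = Phi w.
  move=> /Tgood[TL Te TX]; elim/Vind: w => [l w w' Pw Pw'||w Pw|j].
  - by rewrite TL L -Pw -Pw'.
  - by rewrite (vlin0 TL) Phi0.
  - by rewrite TX PhiX -Pw.
  - by rewrite Te.
have vlin_hd l a b s : size s = k -> v (l *: a + b :: s) = l *: v (a :: s) + v (b :: s).
  by move=> /Tgood[TL Te TX]; rewrite /v (Psi_lin L PhiK PsiK) TL.
have vX a s : size s = k -> v (x * a :: s) = x * v (a :: s) - th (a :: s).
  move=> sk; have [TL Te TX] := Tgood s sk.
  by rewrite /v (PsiX PhiK PsiK PhiX) TX /= T1 // PsiK.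
have v1 s : size s = k -> v (1 :: s) = 0.
  by move=> /Tgood[TL Te TX]; rewrite /v (Psi1 PhiK Phi1) -(expr0 'X) Te.
have vL : mlin k.+1 v.
  split=> // a; rewrite -[a]PsiK; elim/Vind: (Psi a) => [l w w' Pw Pw'||w Pw|j].
  - rewrite L; apply: eq_mlin (mlinD (mlinZ l Pw) Pw') => s sk; by rewrite vlin_hd.
  - rewrite Phi0; apply: eq_mlin (@mlin0 F A k) => s /Tgood[TL Te TX].
    by rewrite /v (_ : Psi 0 = 0) ?(vlin0 TL) //; apply: Phi_inj; rewrite PsiK Phi0.
  - rewrite PhiX; apply: eq_mlin (mlinD (mlinM x Pw) (mlinN (thS (Phi w)))) => s sk.
    by rewrite vX.
  - by apply: eq_mlin (@mlin0 F A k) => s /Tgood[TL Te TX]; rewrite /v PhiK Te.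
clearbody v.
have obsE s : size s = k.+1 -> obs f (fun=> 0) v s = th s - ract th 1 s.
  case: s => // c s [sk]; rewrite obs_split obs0v -thE; congr (_ + _).
  rewrite !ract_cons vX // mul1r.
  rewrite (eq_ract_size (m := fun t => v (x :: t)) (m' := fun t => - th (1 :: t))).
    by rewrite ractN; abel.
  by move=> t; rewrite sk => tk; rewrite -[x]mulr1 vX // v1 // mulr0 add0r.
have [|g [gL gE _ _]] := cochain_ext rel L PhiK PsiK Phi1 PhiX PhiY fL fC (@mlin0 F A k.+1) vL.
  move=> b s sk; rewrite (eq_ract_size (m' := fun t => th t - ract th 1 t)).
    by rewrite ractB ractA mul1r subrr.
  by move=> t; rewrite sk => /obsE.
exists (fun t => - g t); first exact: mlinN.
move=> a [|b s] //= [sk]; rewrite ract_cons gE // ractN mulrN; abel.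
Qed.

(** At the empty argument list the right action is unital, so the extension splits exactly when some
    lifts of x and y have zero obstruction; another choice of lifts changes it by an element of the
    image of [d1]. *)
Lemma cobd2P f : cocy 2 f ->
  cobd 2 f <-> exists U W, obs f (fun=> 0) (fun=> 0) [::] = Phi (d1 h U W).
Proof.
move=> fc; have /cocyP[fL fC] := fc; split=> [[g gL gE]|[U [W E]]].
  have E := @obs_coboundary _ h _ x y rel f g gL; exists (Psi (g [:: x])), (Psi (g [:: y])).
  rewrite -obs_d1 !PsiK.
  have {}E : obs f (fun=> - g [:: x]) (fun=> - g [:: y]) [::] = 0.
    by apply: E => a b; rewrite gE // ract_cons ract_nil; abel.
  rewrite obs_split in E; move/eqP: E; rewrite addr_eq0 => /eqP->.
  have c1 : central (-1 : A) by move=> a; rewrite mulN1r mulrN1.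
  by rewrite -[LHS]mulN1r -obsM //; apply: eq_obs => t; rewrite ?mulr0 // mulN1r opprK.
have [|g [gL gE _ _]] := @cochain_ext _ h _ x y rel Phi Psi L PhiK PsiK Phi1 PhiX PhiY 0 f
    (fun=> Phi (- U)) (fun=> Phi (- W)) fL fC I I.
  move=> b [] // _; rewrite ract_nil obs_split E obs_d1 -(vlinD L).
  have -> : d1 h U W + d1 h (- U) (- W) = 0.
    rewrite -d1D !subrr /d1 /Sop (dlin0 (dlin_Ksum h)) dx0 !(mulr0, derivC, deriv0); ring.
  by rewrite Phi0 mul0r.
exists (fun t => - g t); first exact: mlinN.
by move=> a [|b []] //= _; rewrite ract_cons ract_nil gE // ract_nil mulrN mulNr; abel.
Qed.

Lemma cocy1_d1 f : cocy 1 f -> d1 h (Psi (f [:: x])) (Psi (f [:: y])) = 0.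
Proof.
move=> fc; apply: Phi_inj; rewrite Phi0 -obs_d1 !PsiK.
have := @obs_coboundary _ h _ x y rel (fun=> 0) (fun t => - f t) (mlinN fc.1) _.
rewrite !opprK; apply=> a b; rewrite (cocy1P fc) mulrN mulNr; abel.
Qed.

Lemma cocy1_ext U W : d1 h U W = 0 ->
  exists2 f, cocy 1 f & f [:: x] = Phi U /\ f [:: y] = Phi W.
Proof.
move=> E; have fC : cocyc 0 (fun=> 0 : A).
  by move=> a b c s _; rewrite ract0 mulr0 subr0 addr0.
have [|g [gL gE gx gy]] := @cochain_ext _ h _ x y rel Phi Psi L PhiK PsiK Phi1 PhiX PhiY 0
    (fun=> 0) (fun=> Phi U) (fun=> Phi W) (@mlin0 F A 2) fC I I.
  by move=> b [] // _; rewrite ract_nil obs_d1 E Phi0 mul0r.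
exists g; last by rewrite gx // gy // !ract_nil !mulr0 !mulr1 !addr0 !subr0.
by split=> // a [|b []] // _; rewrite ract_cons ract_nil gE // ract_nil; abel.
Qed.

Lemma cocy1_eq f f' : cocy 1 f -> cocy 1 f' -> f [:: x] = f' [:: x] -> f [:: y] = f' [:: y] ->
  forall a, f [:: a] = f' [:: a].
Proof.
move=> fc f'c fx fy; elim/Aind => [k a b Ha Hb||a Ha|a Ha].
- by rewrite (proj1 fc.1) // (proj1 f'c.1) // Ha Hb.
- by rewrite !cocy1_1.
- by rewrite (cocy1P fc) (cocy1P f'c) Ha fx.
- by rewrite (cocy1P fc) (cocy1P f'c) Ha fy.
Qed.

Lemma cocy_inner b : cocy 1 (fun t => if t is a :: _ then a * b - b * a else 0).
Proof.
split=> [|a [|c []] //= _].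
  split=> [k a c s _|//]; rewrite !(mulrDl, mulrDr) -!scalerAl -!scalerAr scalerBr; abel.
rewrite ract_cons ract_nil /= mulrBr mulrBl !mulrA; abel.
Qed.
End Basis.

(** * Torsion in degree two, and generators in the coprime case *)

Section Basis.
Variables (F : fieldType) (h : {poly F}) (A : algType F) (x y : A).
Local Notation V := {poly {poly F}}.
Local Notation obs := (obs h x y).
Implicit Types (f : seq A -> A) (a b c z : A) (s : seq A) (w : V).
Hypothesis (hn0 : h != 0) (rel : y * x - x * y = horner_alg x h).
Variables (Phi : V -> A) (Psi : A -> V).
Hypotheses (L : vlin Phi) (PhiK : cancel Phi Psi) (PsiK : cancel Psi Phi) (Phi1 : Phi 1 = 1).
Hypotheses (PhiX : forall w, Phi ('X%:P * w) = x * Phi w)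
  (PhiY : forall w, Phi (ly h w) = y * Phi w).

Let Aind := Aind L PsiK Phi1 PhiX PhiY.
Let cobd2P := cobd2P hn0 rel L PhiK PsiK Phi1 PhiX PhiY.
Let Phi0 := Phi0 L.
Let Phi_inj := Phi_inj PhiK.
Let centralP := centralP hn0 L PhiK PsiK Phi1 PhiX PhiY.
Let Phi_mul_const := Phi_mul_const hn0 L PhiK PsiK Phi1 PhiX PhiY.
Let cocy1_d1 := cocy1_d1 hn0 rel L PhiK PsiK Phi1 PhiX PhiY.
Let cocy1_eq := cocy1_eq L PsiK Phi1 PhiX PhiY.
Let comm_x := comm_x L Phi1 PhiX PhiY.
Let comm_y := comm_y hn0 L Phi1 PhiX PhiY.
Let hPn0 : h%:P != 0 :> V. Proof. by rewrite polyC_eq0. Qed.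

Lemma central_const z : central z -> const (Psi z).
Proof. by rewrite -{1}[z]PsiK => /centralP. Qed.

Lemma central_mul z a : central z -> z * a = Phi (Psi z * Psi a).
Proof. by move=> /central_const zc; rewrite -Phi_mul_const // !PsiK. Qed.

Lemma central_eq0 z a : central z -> z != 0 -> z * a = 0 -> a = 0.
Proof.
move=> zc z0; rewrite central_mul // -Phi0 => /Phi_inj/eqP.
rewrite mulf_eq0 => /orP[]/eqP E; last by rewrite -[a]PsiK E Phi0.
by rewrite -[z]PsiK E Phi0 eqxx in z0.
Qed.

(* The first-order deformation of the product along [h ~> h + epsilon]. *)
Lemma deformation_cocycle : exists2 f, cocy 2 f &
  obs f (fun=> 0) (fun=> 0) [::] = 1.
Proof.
(* [del] has commutator 1 with left multiplication by x, so x and y + epsilon [del] act on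
   A[epsilon] with commutator h + epsilon. The cocycle f is the first-order term of the product
   defined by this action on 1; its recursion in y expresses associativity with y as left factor. *)
pose del a := Phi (dx (Psi a)).
have Psi_linE := Psi_lin L PhiK PsiK.
have del_lin k a b : del (k *: a + b) = k *: del a + del b.
  by rewrite /del Psi_linE dxD dxM dxC derivC mul0r add0r L.
have delX a : del (x * a) = a + x * del a.
  by rewrite /del (PsiX PhiK PsiK PhiX) dxM dxC derivX mul1r (vlinD L) PsiK PhiX.
have del1 : del 1 = 0 by rewrite /del (Psi1 PhiK Phi1) dx1 Phi0.
clearbody del.
pose good b (T : V -> A * A) := [/\ vlin T, T 1 = (1, 0),
  forall w, T ('X%:P * w) = (x * (T w).1, x * (T w).2) &
  forall w, T (ly h w) =
    (y * (T w).1, y * (T w).2 + del ((T w).1 * b) - del (T w).1 * b)].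
have [T Tgood] : {T : A -> V -> A * A & forall b, good b (T b)}.
  apply: choice => b.
  have X_lin : linear (fun w : A * A => (x * w.1, x * w.2)).
    by move=> k [u u'] [v v']; congr (_, _); rewrite /= mulrDr scalerAr.
  have Y_lin : linear (fun w : A * A => (y * w.1, y * w.2 + del (w.1 * b) - del w.1 * b)).
    move=> k [u u'] [v v']; rewrite /=; congr (_, _) => /=.
      by rewrite mulrDr scalerAr.
    by rewrite !mulrDl -!scalerAl !del_lin !(mulrDr, mulrDl) -!scalerAl -!scalerAr
      scalerBr scalerDr; abel.
  have relXY (w : A * A) : lin_of Y_lin (lin_of X_lin w) - lin_of X_lin (lin_of Y_lin w) =
      opoly h (lin_of X_lin) w.
    case: w => u v; rewrite /opoly /polysum.
    have iterE n : iter n (lin_of X_lin) (u, v) = (x ^+ n * u, x ^+ n * v).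
      by elim: n => [|n IHn]; rewrite ?mul1r // iterS IHn exprS -!mulrA.
    under eq_bigr => i _ do rewrite iterE.
    rewrite (sum_pair _ (fun i => h`_i) (fun i => x ^+ i * u) (fun i => x ^+ i * v)) /=.
    have hsum c : \sum_(i < size h) h`_i *: (x ^+ i * c) = (y * x - x * y) * c.
      rewrite rel horner_alg_sum mulr_suml; apply: eq_bigr => i _.
      by rewrite scalerAl.
    rewrite !hsum; congr (_, _) => /=; first by rewrite mulrBl !mulrA.
    by rewrite -[x * u * b]mulrA !delX !(mulrDr, mulrDl, mulrN, mulNr) !mulrA; abel.
  by have [T0 [TL T1 TX TY]] := Vext (1, 0) relXY; exists T0.
pose f r := if r is [:: a; b] then (T b (Psi a)).2 else 0.
have T1 b w : (T b w).1 = Phi w.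
  have [TL To TX TY] := Tgood b; elim/(Vind_ly (h := h)): w => [k w w' Pw Pw'||w Pw|w Pw].
  - by rewrite TL L -Pw -Pw'.
  - by rewrite To Phi1.
  - by rewrite TX PhiX -Pw.
  - by rewrite TY PhiY -Pw.
have fX a b : f [:: x * a; b] = x * f [:: a; b].
  by have [TL To TX TY] := Tgood b; rewrite /f (PsiX PhiK PsiK PhiX) TX.
have fY a b : f [:: y * a; b] = y * f [:: a; b] + del (a * b) - del a * b.
  by have [TL To TX TY] := Tgood b; rewrite /f (PsiY PhiK PsiK PhiY) TY T1 PsiK.
have f1 b : f [:: 1; b] = 0.
  by have [TL To TX TY] := Tgood b; rewrite /f (Psi1 PhiK Phi1) To.
have f_lin k a b c : f [:: k *: a + b; c] = k *: f [:: a; c] + f [:: b; c].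
  by have [TL To TX TY] := Tgood c; rewrite /f Psi_linE TL.
clearbody f.
have f_lin2 k a b c : f [:: a; k *: b + c] = k *: f [:: a; b] + f [:: a; c].
  elim/Aind: a => [l a a' Ha Ha'||a Ha|a Ha].
  - by rewrite !f_lin Ha Ha' !scalerDr !scalerA [l * k]mulrC; abel.
  - by rewrite !f1 scaler0 addr0.
  - by rewrite !fX Ha mulrDr scalerAr.
  - rewrite !fY Ha !mulrDr -!scalerAr del_lin !scalerDr scalerN; abel.
exists f.
  apply/cocyP; split.
    split=> [k a b [|c []] // _|a]; split=> // k b c [] // _; exact: f_lin2.
  move=> a b c [] // _; rewrite ract_nil.
  elim/Aind: a b c => [k a a' Ha Ha' b c|b c|a Ha b c|a Ha b c].
  - have {}Ha := Ha b c; have {}Ha' := Ha' b c.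
    rewrite !mulrDl -!scalerAl !f_lin !mulrDl -!scalerAl -Ha -Ha' scalerDr scalerBr; abel.
  - by rewrite !mul1r !f1 mul0r addr0 subrr.
  - by rewrite -!mulrA !fX -mulrA -Ha !mulrDr mulrN !mulrA.
  - by rewrite -!mulrA !fY !mulrBl !mulrDl -!mulrA -Ha !mulrDr mulrN !mulrA; abel.
have fx b : f [:: x; b] = 0 by rewrite -[x]mulr1 fX f1 mulr0.
rewrite /obs big1 => [|i _].
  rewrite !ract0 !mulr0 fx -[y]mulr1 fY f1 del1 mul1r -[x]mulr1 delX del1.
  by rewrite !mulr0 mul0r; abel.
suff -> : obs_pow x f (fun=> 0) i [::] = 0 by rewrite scaler0.
by elim: (i : nat) => [|n IHn] /=; rewrite ?f1 ?oppr0 // IHn fx ract0 mulr0 !addr0.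
Qed.

Lemma obs_cocy_scale f z : central z -> obs (fun t => z * f t) (fun=> 0) (fun=> 0) [::] =
  z * obs f (fun=> 0) (fun=> 0) [::].
Proof. by move=> zc; rewrite -obsM //; apply: eq_obs => t; rewrite ?mulr0. Qed.

Lemma torsion_cocycle (p : nat) : p \in [pchar F] -> ~~ coprimep h h^`() ->
  exists f z, [/\ cocy 2 f, ~ cobd 2 f, central z, z != 0 & cobd 2 (fun s => z * f s)].
Proof.
move=> hp ncop; have [f fc f_obs] := deformation_cocycle.
have [[al be] /= Eg] := Bezoutp h h^`(); set g := _ + _ in Eg.
have g0 : g != 0.
  apply/eqP => g0; move: Eg; rewrite g0 eqp_sym eqp0 gcdp_eq0 => /andP[].
  by rewrite (negPf hn0).
have [r hr] : exists r, h = g * r.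
  have /dvdpP[r hr] : g %| h by rewrite (eqp_dvdl _ Eg) dvdp_gcdl.
  by exists r; rewrite mulrC.
have [r' hr'] : exists r, h^`() = g * r.
  have /dvdpP[r' hr'] : g %| h^`() by rewrite (eqp_dvdl _ Eg) dvdp_gcdr.
  by exists r'; rewrite mulrC.
have pp := prime_gt0 (pcharf_prime hp).
have zc : central (Phi (g ^+ p)%:P).
  by apply/centralP; split; rewrite ?derivC // dxC (deriv_exp_pchar hp) polyC0.
exists f, (Phi (g ^+ p)%:P); split=> //.
- move=> /(cobd2P fc)[U [W]]; rewrite f_obs -Phi1 => /Phi_inj E.
  have [w wE] := d1_dvd U W hr hr'; move: E; rewrite wE.
  move=> /(congr1 (fun q : V => q`_0)); rewrite coefCM coefC eqxx => E.
  case/negP: ncop; rewrite /coprimep -(eqp_size Eg) -dvdp1.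
  by apply/dvdpP; exists w`_0; rewrite mulrC.
- apply/eqP; rewrite -Phi0 => /Phi_inj/eqP.
  by rewrite polyC_eq0 expf_eq0 (negPf g0) andbF.
- apply/(cobd2P (cocyM zc fc)).
  (* By [d1_polyC] these witnesses give g^(p-1) (al h + be h') = g^p: the part -rr' of the second
     one cancels the term h rr'. *)
  pose rr := - (g ^+ p.-1 * be).
  exists rr%:P, ((g ^+ p.-1 * al - rr^`())%:P * 'X).
  rewrite obs_cocy_scale // f_obs mulr1 d1_polyC; congr (Phi _%:P).
  by rewrite -(prednK pp) exprS {1}/g /rr /=; move: (deriv (- _)) => d; ring.
Qed.

Section Coprime.
Variables (p : nat) (hp : p \in [pchar F]) (al be : {poly F}).
Hypothesis hab : al * h + be * h^`() = 1.
Local Notation e1 := (coker_gen p h al be).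
Local Notation Xp := ('X^(p.-1) : V).
Let hP : p \in [pchar {poly F}]. Proof. by rewrite pchar_poly. Qed.

(** Moving a polynomial in x from right to left costs only xi-derivatives, which lie in the image of
    [d1] by [d1_exact]. *)
Lemma Phi_mul_polyC (q : {poly F}) w :
  exists G, Phi w * Phi q%:P = Phi (w * q%:P + G^`()).
Proof.
elim/poly_ind: q w => [|q c IHq] w.
  by exists 0; rewrite deriv0 polyC0 mulr0 addr0 Phi0 mulr0.
have [G E] := IHq (rx h w); exists (h%:P * q%:P * w + G).
rewrite (_ : (q * 'X + c%:P)%:P = 'X%:P * q%:P + c%:P%:P * 1); last first.
  by rewrite mulr1 rmorphD rmorphM mulrC.
rewrite (vlinD L) PhiX (vlinZ L) Phi1 mulrDr mulrA -(Phi_rx L Phi1 PhiX PhiY) E.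
rewrite -scalerAr !mulr1 -(vlinZ L) -(vlinD L); congr Phi.
by rewrite derivD -mulrA !deriv_mulC /rx; ring.
Qed.

Section Generators.
Variables D1 D2 : seq A -> A.
Hypotheses (D1c : cocy 1 D1) (D2c : cocy 1 D2).
Hypotheses (D1x : D1 [:: x] = Phi (h%:P * Xp)) (D2x : D2 [:: x] = 0)
  (D2y : D2 [:: y] = Phi e1%:P).

Definition cup (s : seq A) : A := if s is [:: a; b] then D1 [:: a] * D2 [:: b] else 0.

Lemma cup_cocy : cocy 2 cup.
Proof.
have [[D1l _] _] := D1c; have [[D2l _] _] := D2c.
apply/cocyP; split.
  split=> [k a b [|c []] // _|a] /=; first by rewrite D1l // mulrDl -scalerAl.
  by split=> // k b c [] // _; rewrite /= D2l // mulrDr scalerAr.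
move=> a b c [] // _; rewrite ract_nil /= (cocy1P D1c) (cocy1P D2c).
by rewrite mulrDl mulrDr !mulrA; abel.
Qed.

(** D2 vanishes on the powers of x, so only the term -f(x, y) of the obstruction survives; this sign
    is the source of [- Phi Z] in [HH2_span]. *)
Lemma cup_obs : exists G,
  obs cup (fun=> 0) (fun=> 0) [::] = - Phi (h%:P * Xp * e1%:P + G^`()).
Proof.
have [G E] := Phi_mul_polyC e1 (h%:P * Xp); exists G; rewrite -E -D1x -D2y.
have D2xn n : D2 [:: x ^+ n] = 0.
  elim: n => [|n IHn]; first exact: cocy1_1.
  by rewrite exprS (cocy1P D2c) IHn D2x mulr0 mul0r addr0.
rewrite /obs big1 => [|i _]; first by rewrite /= !ract0 !mulr0 D2x mulr0; abel.
suff -> : obs_pow x cup (fun=> 0) i [::] = 0 by rewrite scaler0.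
elim: (i : nat) => [|n IHn] /=; first by rewrite -(expr0 x) D2xn mulr0 oppr0.
by rewrite IHn ract0 D2xn !mulr0 !addr0.
Qed.

(** The value at x is removed by z1 D1 and the inner derivation of B, then the value at y by z2 D2
    and the inner derivation of g; the latter does not disturb the value at x because g_xi = 0. *)
Lemma HH1_span f : cocy 1 f -> exists z1 z2, [/\ central z1, central z2 &
  cobd 1 (fun s => f s - (z1 * D1 s + z2 * D2 s))].
Proof.
move=> fc; have [Z1 Z1c [B UE]] := ker_d1_left hp hab (cocy1_d1 fc).
have z1c : central (Phi Z1) by apply/centralP.
pose f1 s := f s + - (Phi Z1 * D1 s) + (if s is a :: _ then a * Phi B - Phi B * a else 0).
have f1c : cocy 1 f1.
  exact: cocyD (cocyD fc (cocyN (cocyM z1c D1c))) (cocy_inner (Phi B)).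
have f1x : f1 [:: x] = 0.
  rewrite /f1 D1x Phi_mul_const // -[f _]PsiK UE (vlinD L).
  by rewrite -comm_x; abel.
have := cocy1_d1 f1c.
have Psi0 : Psi 0 = 0 by apply: Phi_inj; rewrite PsiK Phi0.
rewrite f1x Psi0 => /(ker_d1_right hp hab)[Z2 Z2c [g g0 WE]].
have z2c : central (Phi Z2) by apply/centralP.
exists (Phi Z1), (Phi Z2); split=> //.
exists (fun=> Phi g - Phi B) => // a [] // _; rewrite ract_nil.
pose f2 s := f1 s + - (Phi Z2 * D2 s) + - (if s is a :: _ then a * Phi g - Phi g * a else 0).
have f2c : cocy 1 f2.
  exact: cocyD (cocyD f1c (cocyN (cocyM z2c D2c))) (cocyN (cocy_inner (Phi g))).
have : f2 [:: a] = 0.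
  apply: (cocy1_eq f2c (cocy0 A 1)).
    rewrite /f2 f1x D2x mulr0 oppr0 !add0r -opprB opprK.
    by rewrite comm_x g0 mulr0 Phi0.
  rewrite /f2 D2y -[f1 _]PsiK WE Phi_mul_const // (vlinD L).
  by rewrite (comm_y g0); abel.
rewrite /f2 /f1 => E; rewrite -[LHS]subr0 -E mulrBr mulrBl; abel.
Qed.

(** Evaluation at x makes z1 xi^(p-1) exact, so z1 = 0 and M_xi = 0; evaluation at y then reads z2
    [e1] = h M_x. *)
Lemma HH1_free z1 z2 : central z1 -> central z2 ->
  cobd 1 (fun s => z1 * D1 s + z2 * D2 s) -> z1 = 0 /\ z2 = 0.
Proof.
move=> z1c z2c [m _ mE]; have [z10 z11] := central_const z1c.
have [z20 z21] := central_const z2c.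
pose M := Psi (m [::]); have mM : m [::] = Phi M by rewrite PsiK.
have := mE x [::] erefl; rewrite ract_nil D1x D2x mulr0 addr0 central_mul // PhiK mM.
rewrite -opprB comm_x -(vlinN L) => /Phi_inj E.
have E1 : Psi z1 * Xp = (- M)^`().
  by apply: (mulfI hPn0); rewrite derivN mulrN -E mulrCA.
have Z1 : Psi z1 = 0 by exact: (exact_uniq hP z10 E1).
have M0 : M^`() = 0 by apply/eqP; rewrite -oppr_eq0 -derivN -E1 Z1 mul0r.
have z1E : z1 = 0 by rewrite -[z1]PsiK Z1 Phi0.
split=> //; have := mE y [::] erefl.
rewrite ract_nil z1E mul0r add0r D2y central_mul // PhiK mM.
rewrite (comm_y M0) => /Phi_inj E2.
by rewrite -[z2]PsiK (coker_gen_free2 hp hab z21 E2) Phi0.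
Qed.

Lemma HH2_span f : cocy 2 f ->
  exists2 z, central z & cobd 2 (fun s => f s - z * cup s).
Proof.
move=> fc; pose w := Psi (obs f (fun=> 0) (fun=> 0) [::]).
have [Z Zc [U [W wE]]] := d1_decomp hp hab w.
have [G GE] := cup_obs; have [U' [W' E']] := d1_exact hab (Z * G).
have zc : central (Phi Z) by apply/centralP.
exists (- Phi Z) => [a|]; first by rewrite mulNr mulrN zc.
have : cobd 2 (fun s => f s + Phi Z * cup s).
  apply/cobd2P; first exact: cocyD fc (cocyM zc cup_cocy).
  exists (U - U'), (W - W').
  transitivity (obs f (fun=> 0) (fun=> 0) [::]
      + Phi Z * obs cup (fun=> 0) (fun=> 0) [::]).
    by rewrite -obs_cocy_scale // -obsD; apply: eq_obs => t; rewrite ?addr0.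
  rewrite GE -[obs f _ _ _]PsiK -/w wE mulrN Phi_mul_const //.
  rewrite -(vlinB L); congr Phi.
  have -> : d1 h U W = d1 h (U - U') (W - W') + d1 h U' W' by rewrite -d1D !subrK.
  by rewrite -E' derivM; case: Zc => -> _; rewrite rmorphM /=; ring.
by apply: cobd_eq => s _; rewrite mulNr opprK.
Qed.

Lemma HH2_free z : central z -> cobd 2 (fun s => z * cup s) -> z = 0.
Proof.
move=> zc /(cobd2P (cocyM zc cup_cocy))[U [W]]; have [G GE] := cup_obs.
rewrite obs_cocy_scale // GE -(vlinN L) central_mul // PhiK => /Phi_inj E.
have [z0 z1] := central_const zc.
have /eqP : - Psi z = 0.
  apply: (@d1_free _ p hp h al be hab (- Psi z) (- Psi z * G) U W).
    by split; rewrite ?derivN ?dxN ?z0 ?z1 oppr0.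
  by rewrite -E derivM derivN z0 !rmorphM /=; ring.
by rewrite oppr_eq0 => /eqP Z; rewrite -[z]PsiK Z Phi0.
Qed.
End Generators.
End Coprime.
End Basis.

(** * Freeness of the cohomology modules *)

Section Graded.
Variables (F : fieldType) (A : algType F).
Implicit Types (c : nat -> seq A -> A) (D : pred nat).

Definition bounded c := exists N, forall n s, (N <= n)%N -> size s = n -> c n s = 0.

Lemma hdiff0P n f : (forall s, size s = n.+1 -> hdiff n f s = 0) <->
  (forall (a : A) s, size s = n -> a * f s = ract f a s).
Proof.
split=> [H a s sn|H [|a s] //= [sn]]; last by rewrite hdiffE // H ?subrr.
by apply/eqP; rewrite -subr_eq0 -(hdiffE f a sn) H //= sn.
Qed.

Lemma gcocycleP D c : gcocycle D c <-> [/\ forall n, cocy n (c n),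
  forall n s, ~~ D n -> size s = n -> c n s = 0 & bounded c].
Proof.
split=> [[[cL cD cN] cC]|[cC cD cN]].
  split=> // n; split; first exact/multilinearP.
  by apply/hdiff0P => s; apply: cC.
split; first by split=> // n; apply/multilinearP; case: (cC n).
by move=> n; apply/hdiff0P; case: (cC n).
Qed.

Lemma gcobound_cobd c n : gcobound c -> cobd n (c n).
Proof.
move=> [g [[gL _ _] gE]]; case: n => [|n]; first exact: gE.
exists (g n); first exact/multilinearP.
by move=> a s sn; rewrite gE /= ?sn // hdiffE.
Qed.

Lemma cobd_gcobound c : (forall n, cobd n (c n)) -> bounded c -> gcobound c.
Proof.
move=> cB [N cN].
(* Primitives chosen degree by degree need a common bound; from N on the zero primitive serves,
   because c vanishes there. *)
have [g gP] : {g : nat -> seq A -> A & forall m, [/\ mlin m (g m),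
    forall a s, size s = m -> c m.+1 (a :: s) = a * g m s - ract (g m) a s &
    (N <= m)%N -> forall s, g m s = 0]}.
  apply: (@choice _ _ (fun m g => [/\ mlin m g,
    forall a s, size s = m -> c m.+1 (a :: s) = a * g s - ract g a s &
    (N <= m)%N -> forall s, g s = 0])) => m.
  have [Nm|Nm] := leqP N m; last by have [g gL gE] := cB m.+1; exists g; split.
  exists (fun=> 0); split=> [|a s sm|//]; first exact: mlin0.
  by rewrite cN ?ract0 ?mulr0 ?subrr /= ?sm // leqW.
exists g; split.
  split=> // [n|]; first by apply/multilinearP; case: (gP n).
  by exists N => n s Nn _; case: (gP n) => _ _; apply.
move=> [|n] [|a s] //= sn; first exact: (cB 0).
case: sn => sn.
by rewrite hdiffE //; case: (gP n) => _ gE _; rewrite gE.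
Qed.

Lemma lincomb_regroup (I : finType) (b : I -> nat -> seq A -> A) k (idx : 'I_k -> I)
    (z : 'I_k -> A) n s :
  lincomb b idx z n s = \sum_i (\sum_(j | idx j == i) z j) * b i n s.
Proof.
rewrite /lincomb (partition_big idx predT) //=; apply: eq_bigr => i _.
by rewrite mulr_suml; apply: eq_bigr => j /eqP->.
Qed.

Lemma central0 : central (0 : A). Proof. by move=> a; rewrite mul0r mulr0. Qed.
Lemma centralD (z z' : A) : central z -> central z' -> central (z + z').
Proof. by move=> zc zc' a; rewrite mulrDl mulrDr zc zc'. Qed.
Lemma central_sum (I : finType) (P : pred I) (z : I -> A) :
  (forall i, central (z i)) -> central (\sum_(i | P i) z i).
Proof. by move=> zc; elim/big_ind: _ => *; [exact: central0|exact: centralD|exact: zc]. Qed.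

Lemma bounded_lincomb I (b : I -> nat -> seq A -> A) k (idx : 'I_k -> I) z :
  (forall i, bounded (b i)) -> bounded (lincomb b idx z).
Proof.
move=> bB; have [N NP] := choice bB.
exists (\max_(j < k) N (idx j)) => n s Nn sn; apply: big1 => j _.
by rewrite (NP (idx j)) ?mulr0 // (leq_trans _ Nn) // (leq_bigmax j).
Qed.

Lemma HH_free_withP D (I : finType) (b : I -> nat -> seq A -> A) :
  (forall i, gcocycle D (b i)) ->
  (forall c, gcocycle D c -> exists2 z : I -> A, forall i, central (z i) &
     forall n, cobd n (fun s => c n s - \sum_i z i * b i n s)) ->
  (forall z : I -> A, (forall i, central (z i)) ->
     (forall n, cobd n (fun s => \sum_i z i * b i n s)) -> forall i, z i = 0) ->
  HH_free_with A D I.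
Proof.
move=> bc span free; exists b; split=> // [c cc|k idx z idx_inj zc cb j].
  have [z zc cz] := span c cc; pose ev (j : 'I_#|I|) : I := enum_val j; exists #|I|, ev, (z \o ev).
  split=> [j|]; first exact: zc.
  have E n s : lincomb b ev (z \o ev) n s = \sum_i z i * b i n s.
    rewrite /lincomb [RHS](reindex_onto ev enum_rank) => [|i _]; last exact: enum_rankK.
    by apply: eq_bigl => j; rewrite /= enum_valK eqxx.
  apply: cobd_gcobound => [n|].
    by apply: cobd_eq (cz n) => s _; rewrite E.
  have /gcocycleP[_ _ [N NP]] := cc.
  have [N' NP'] : bounded (lincomb b ev (z \o ev)).
    by apply: bounded_lincomb => i; have /gcocycleP[] := bc i.
  exists (maxn N N') => n s; rewrite geq_max => /andP[Nn N'n] sn.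
  by rewrite NP // NP' // subrr.
pose Z i := \sum_(j | idx j == i) z j.
have Zc i : central (Z i) by apply: central_sum.
have := free Z Zc _ (idx j); rewrite /Z (big_pred1 j) => [->//|j'].
  by move=> n; apply: cobd_eq (gcobound_cobd n cb) => s _; rewrite lincomb_regroup.
by rewrite (inj_eq idx_inj).
Qed.

(** Spanning allows repeated indices whereas independence speaks of distinct ones, so equal indices
    are merged; [I] is an arbitrary type, hence the classical decision of equality on it. *)
Lemma lincomb_inj I (b : I -> nat -> seq A -> A) k (idx : 'I_k -> I) (z : 'I_k -> A) :
  (forall j, central (z j)) -> exists k' (idx' : 'I_k' -> I) (z' : 'I_k' -> A),
  [/\ injective idx', forall j, central (z' j) &
      forall n s, lincomb b idx z n s = lincomb b idx' z' n s].
Proof.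
move=> zc; pose T : finType := seq_sub (codom (idx : 'I_k -> {classic I})).
pose ev (j : 'I_#|T|) : T := enum_val j.
pose val' (t : T) : I := val t.
pose f (j : 'I_k) : T := SeqSub (codom_f (idx : 'I_k -> {classic I}) j).
exists #|T|, (fun j => val' (ev j)), (fun j => \sum_(i | f i == ev j) z i).
split=> [i j ij|j|n s]; first by apply: enum_val_inj; apply: val_inj.
  exact: central_sum.
rewrite -[LHS]/(lincomb (b \o val') f z n s) lincomb_regroup.
rewrite (reindex_onto ev enum_rank) => [|i _]; last exact: enum_rankK.
by apply: eq_bigl => j; rewrite /= enum_valK eqxx.
Qed.
End Graded.

Section Concentrated.
Variables (F : fieldType) (A : algType F).

Definition in_degree d (f : seq A -> A) (n : nat) (s : seq A) : A :=
  if n == d then f s else 0.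

Lemma gcocycle_in_degree (D : pred nat) d f : D d -> cocy d f -> gcocycle D (in_degree d f).
Proof.
move=> Dd fc; apply/gcocycleP; split=> [n|n s|].
- by rewrite /in_degree; case: eqP => [->|_]; [exact: fc|exact: cocy0].
- by rewrite /in_degree; case: eqP => // ->; rewrite Dd.
- by exists d.+1 => n s dn _; rewrite /in_degree gtn_eqF.
Qed.
End Concentrated.

(** Expanding a torsion class f in a basis, z f = 0 gives z w_j = 0 for every coefficient. As z is
    not a zero divisor all w_j vanish, and f would bound. *)
Lemma HH2_free_coprime (F : fieldType) (p : nat) (hp : p \in [pchar F]) (h : {poly F})
    (hn0 : h != 0) (A : algType F) (x y : A) :
  presented_Ah h x y -> HH_free A (pred1 2%N) -> coprimep h h^`().
Proof.
move=> hA [I [b [bc span free]]]; apply/negP => /negP ncop.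
have [Phi [L [Psi PhiK PsiK] P1 PX PY]] := presented_basis hA.
have [rel _] := hA.
have [f [z [fc fnb zc z0 zfb]]] :=
  torsion_cocycle hn0 rel L PhiK PsiK P1 PX PY hp ncop.
have [k0 [idx0 [w0 [w0c cb0]]]] := span _ (gcocycle_in_degree (D := pred1 2) (eqxx 2) fc).
have [k [idx [w [idx_inj wc wE]]]] := lincomb_inj b idx0 w0c.
have cb2 : cobd 2 (fun s => f s - lincomb b idx w 2 s).
  by apply: cobd_eq (gcobound_cobd 2 cb0) => s _; rewrite -wE.
have b_off i n s : n != 2 -> size s = n -> b i n s = 0.
  by move=> n2 sn; have /gcocycleP[_ H _] := bc i; apply: H.
have zw0 j : z * w j = 0.
  apply: (free k idx (fun j => z * w j)) => // [i a|].
    by rewrite -mulrA wc mulrA zc -mulrA.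
  have bB : bounded (lincomb b idx (fun j => z * w j)).
    by apply: bounded_lincomb => i; have /gcocycleP[] := bc i.
  apply: (cobd_gcobound _ bB) => n; have [->|n2] := eqVneq n 2.
    apply: cobd_eq (cobdD zfb (cobdN (cobdM zc cb2))) => s _.
    rewrite mulrBr opprB addrCA subrr addr0 /lincomb mulr_sumr.
    by apply: eq_bigr => i _; rewrite mulrA.
  by apply: cobd_eq (cobd0 A n) => s sn; rewrite /lincomb big1 // => i _; rewrite b_off ?mulr0.
apply: fnb; apply: cobd_eq cb2 => s _; rewrite /lincomb big1 ?subr0 // => j _.
by rewrite (central_eq0 hn0 L PhiK PsiK P1 PX PY zc z0 (zw0 j)) mul0r.
Qed.

Lemma HH_free_of_coprime (F : fieldType) (p : nat) (hp : p \in [pchar F]) (h : {poly F})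
    (A : algType F) (x y : A) :
  presented_Ah h x y -> coprimep h h^`() ->
  HH_free_with A (pred1 2%N) unit /\ HH_free_with A predT 'I_4.
Proof.
move=> hA cop; have hn0 : h != 0.
  apply: contraTneq cop => ->; rewrite deriv0 coprimep0 -size_poly_eq1 size_poly0 //.
have /Bezout_eq1_coprimepP[[al be] /= hab] := cop.
have [Phi [L [Psi PhiK PsiK] P1 PX PY]] := presented_basis hA.
have [rel _] := hA.
have [D1 D1c [D1x _]] :=
  cocy1_ext hn0 rel L PhiK PsiK P1 PX PY (d1_gen1 hp h).
have d1_gen2 : d1 h 0 (coker_gen p h al be)%:P = 0.
  by rewrite /d1 /Sop (dlin0 (dlin_Ksum h)) dx0 !(mulr0, derivC, addr0, subr0).
have [D2 D2c [D2x D2y]] := cocy1_ext hn0 rel L PhiK PsiK P1 PX PY d1_gen2.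
rewrite (vlin0 L) in D2x.
have cupc := cup_cocy D1c D2c.
have span1 := HH1_span hn0 rel L PhiK PsiK P1 PX PY hp hab D1c D2c D1x D2x D2y.
have free1 := HH1_free hn0 L PhiK PsiK P1 PX PY hp hab D1x D2x D2y.
have span2 := HH2_span hn0 rel L PhiK PsiK P1 PX PY hp hab D1c D2c D1x D2x D2y.
have free2 := HH2_free hn0 rel L PhiK PsiK P1 PX PY hp hab D1c D2c D1x D2x D2y.
pose C := cup D1 D2; rewrite -/C in cupc span2 free2.
split.
  apply: (HH_free_withP (b := fun=> in_degree 2 C)) => [i|c|z zc cb []].
  - exact: gcocycle_in_degree.
  - move=> /gcocycleP[cc cD _]; have [z zc cz] := span2 _ (cc 2).
    exists (fun=> z) => // n; have [->|n2] := eqVneq n 2.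
      by apply: cobd_eq cz => s _; rewrite (big_pred1 tt) // => -[].
    apply: cobd_eq (cobd0 A n) => s sn.
    by rewrite cD // big1 ?subrr // => i _; rewrite /in_degree (negPf n2) mulr0.
  - apply: free2 => //; apply: cobd_eq (cb 2) => s _.
    by rewrite (big_pred1 tt) // => -[].
(* The basis 1, D1, D2 and the cup product of D1 and D2 sits in degrees 0, 1, 1, 2; nothing is left
   above, by [cobd_ge3]. *)
pose B (i : 'I_4) := in_degree (nth 0 [:: 0; 1; 1; 2] i)%N
  (nth (fun=> 0) [:: fun=> 1; D1; D2; C] i).
have one_c : cocy 0 (fun=> 1 : A).
  by split=> // a [] // _; rewrite ract_nil mulr1 mul1r.
have BE (z : 'I_4 -> A) n s : \sum_i z i * B i n s =
    if n == 0%N then z ord0 else if n == 1%N then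
      z (lift ord0 ord0) * D1 s + z (lift ord0 (lift ord0 ord0)) * D2 s
    else if n == 2%N then z (lift ord0 (lift ord0 (lift ord0 ord0))) * C s else 0.
  rewrite !big_ord_recl big_ord0 /B /in_degree /=.
  by case: n => [|[|[|n]]] /=; rewrite ?mulr1 ?mulr0 ?addr0 ?add0r.
apply: (HH_free_withP (b := B)) => [[[|[|[|[|//]]]] i4]|c|z zc cb].
- exact: gcocycle_in_degree.
- exact: gcocycle_in_degree.
- exact: gcocycle_in_degree.
- exact: gcocycle_in_degree.
- move=> /gcocycleP[cc _ _].
  have [z1 [z2 [z1c z2c c1]]] := span1 _ (cc 1%N); have [z3 z3c c2] := span2 _ (cc 2).
  have z0c : central (c 0%N [::]).
    by move=> a; have [_ H] := cc 0%N; rewrite (H a [::]) // ract_nil.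
  exists (fun i : 'I_4 => nth 0 [:: c 0%N [::]; z1; z2; z3] i).
    by case=> -[|[|[|[|]]]].
  move=> n; case: n => [|[|[|n]]].
  + by rewrite /= BE /= subrr.
  + by apply: cobd_eq c1 => s _; rewrite BE.
  + by apply: cobd_eq c2 => s _; rewrite BE.
  + by apply: cobd_eq (cobd_ge3 rel L PhiK PsiK P1 PX PY (cc n.+3)) => s _; rewrite BE subr0.
have z0 : z ord0 = 0 by have := cb 0%N; rewrite /= BE.
have [z1 z2] : z (lift ord0 ord0) = 0 /\ z (lift ord0 (lift ord0 ord0)) = 0.
  by apply: free1 => //; apply: cobd_eq (cb 1%N) => s _; rewrite BE.
have z3 : z (lift ord0 (lift ord0 (lift ord0 ord0))) = 0.
  by apply: free2 => //; apply: cobd_eq (cb 2) => s _; rewrite BE.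
case=> -[|[|[|[|//]]]] i4; [rewrite -z0|rewrite -z1|rewrite -z2|rewrite -z3];
  by congr z; apply: val_inj.
Qed.

Theorem theorem3p9 (F : fieldType) (p : nat) (hp : p \in [pchar F])
  (h : {poly F}) (hnz : h != 0) (A : algType F) (x y : A)
  (hA : presented_Ah h x y) :
  (HH_free A (pred1 2%N) <-> coprimep h h^`()) /\
  (coprimep h h^`() -> HH_free_with A (pred1 2%N) unit /\ HH_free A predT).
Proof.
split=> [|cop].
  split=> [|cop]; first exact: (HH2_free_coprime hp hnz hA).
  by exists unit; have [] := HH_free_of_coprime hp hA cop.
by have [H2 H] := HH_free_of_coprime hp hA cop; split=> //; exists 'I_4.
Qed.
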